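(* Let $\vartheta_{\mathbf{P}}$ be a primitive random substitution with unique realisation paths, with Perron--Frobenius eigenvalue $\lambda$, right Perron--Frobenius eigenvector $\mathbf{R}$ and frequency measure $\mu_{\mathbf{P}}$. Then, for all $k\in\mathbb{N}$, $$\frac{1}{\lambda^k}\,\mathbf{H}_k^{\top}\mathbf{R}\;\le\; h(\mu_{\mathbf{P}})\;\le\;\frac{1}{\lambda^k-1}\,\mathbf{H}_k^{\top}\mathbf{R},$$ where the upper bound is an equality if and only if $\vartheta_{\mathbf{P}}^k$ satisfies the disjoint set condition, and the lower bound is an equality if and only if $\vartheta_{\mathbf{P}}^k$ satisfies the identical set condition with identical production probabilities. Further, the sequence of lower bounds $(\lambda^{-n}\mathbf{H}_n^{\top}\mathbf{R})_{n\in\mathbb{N}}$ is non-decreasing in $n$.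
   Context: $\mathbb{N}=\{1,2,\dots\}$. $\mathcal{A}=\{a_1,\dots,a_d\}$ is a finite alphabet, $\mathcal{A}^+$ the set of non-empty finite words, $|u|$ the length of a word $u$, and $|u|_v$ the number of (possibly overlapping) occurrences of $v$ as a subword of $u$. A random substitution $\vartheta_{\mathbf{P}}=(\vartheta,\mathbf{P})$ is a map $\vartheta$ assigning to each letter $a_i$ a non-empty finite set $\vartheta(a_i)=\{s^{(i,1)},\dots,s^{(i,r_i)}\}\subset\mathcal{A}^+$ of $r_i$ distinct words, together with probability vectors $\mathbf{p}_i=(p_{i,1},\dots,p_{i,r_i})$ with all $p_{i,j}>0$; $\vartheta_{\mathbf{P}}(a_i)$ is the random word equal to $s^{(i,j)}$ with probability $p_{i,j}$. It is extended to words by applying it independently to each letter and concatenating the results; $(\vartheta_{\mathbf{P}}^n(u))_{n}$ is the Markov chain obtained by iterating this with fresh independent choices at each step, starting from $u$. $\mathbb{P},\mathbb{E}$ denote the corresponding probability and expectation, and $\vartheta^n(u)=\{v:\mathbb{P}[\vartheta_{\mathbf{P}}^n(u)=v]>0\}$. The power $\vartheta_{\mathbf{P}}^k$ is again a random substitution, with set-valued map $a\mapsto\vartheta^k(a)$ and the induced probabilities. The substitution matrix is $M_{i,j}=\mathbb{E}[|\vartheta_{\mathbf{P}}(a_j)|_{a_i}]$. $\vartheta_{\mathbf{P}}$ is primitive if $M$ is primitive and its Perron--Frobenius eigenvalue satisfies $\lambda>1$. $\mathbf{R}$ is the right Perron--Frobenius eigenvector of $M$, with positive entries summing to $1$. The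 language $\mathcal{L}_\vartheta$ is the set of words occurring as subwords of some word in $\vartheta^k(a)$, $a\in\mathcal{A}$, $k\in\mathbb{N}$; $\mathcal{L}_\vartheta^n=\mathcal{L}_\vartheta\cap\mathcal{A}^n$. $X_\vartheta\subset\mathcal{A}^{\mathbb{Z}}$ is the set of bi-infinite sequences all of whose finite subwords lie in $\mathcal{L}_\vartheta$, with left shift $S$. For $v\in\mathcal{L}_\vartheta$, $[v]=\{x\in X_\vartheta: x_0\cdots x_{|v|-1}=v\}$. The frequency measure $\mu_{\mathbf{P}}$ is the unique shift-invariant Borel probability measure on $X_\vartheta$ with $\mu_{\mathbf{P}}([v])=\lim_{k\to\infty}\mathbb{E}[|\vartheta_{\mathbf{P}}^k(a)|_v]/\mathbb{E}[|\vartheta_{\mathbf{P}}^k(a)|]$ for all $v\in\mathcal{L}_\vartheta$ (the limit exists and is independent of $a$; $\mu_{\mathbf{P}}$ is ergodic). Its entropy is $h(\mu_{\mathbf{P}})=\lim_{n\to\infty}\frac1n\sum_{u\in\mathcal{L}_\vartheta^n}-\mu_{\mathbf{P}}([u])\log\mu_{\mathbf{P}}([u])$. $\mathbf{H}_m=(H_{m,a})_{a\in\mathcal{A}}$ with $H_{m,a}=\sum_{w\in\vartheta^m(a)}-\mathbb{P}[\vartheta_{\mathbf{P}}^m(a)=w]\log\mathbb{P}[\vartheta_{\mathbf{P}}^m(a)=w]$. Unique realisation paths: for every $n,k\in\mathbb{N}$ and $v=v_1\cdots v_n\in\mathcal{L}_\vartheta^n$, the random vector $(\vartheta_{\mathbf{P}}^k(v_1),\dots,\vartheta_{\mathbf{P}}^k(v_n))$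 is determined by its concatenation $\vartheta_{\mathbf{P}}^k(v)$; equivalently, the concatenation map $\vartheta^k(v_1)\times\cdots\times\vartheta^k(v_n)\to\mathcal{L}_\vartheta$ is injective. For a random substitution $\vartheta_{\mathbf{P}}$ (to be applied to the power in question): the disjoint set condition says that for all $a\in\mathcal{A}$, $k\in\mathbb{N}$ and $u\ne v$ in $\vartheta(a)$ one has $\vartheta^k(u)\cap\vartheta^k(v)=\varnothing$. The identical set condition says that for all $a\in\mathcal{A}$, $k\in\mathbb{N}$ and $u,v\in\vartheta(a)$ one has $\vartheta^k(u)=\vartheta^k(v)$. A random substitution satisfying the identical set condition has identical production probabilities if for all $a\in\mathcal{A}$, all integers $k\ge2$, all $v\in\vartheta^k(a)$ and all $u_1,u_2\in\vartheta(a)$, $\mathbb{P}[\vartheta_{\mathbf{P}}^{k-1}(u_1)=v]=\mathbb{P}[\vartheta_{\mathbf{P}}^{k-1}(u_2)=v]$. *)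

(* Defs.v *)
From HB Require Import structures.
From mathcomp Require Import all_boot all_order all_algebra.
From mathcomp Require Import finmap complex.
From mathcomp Require Import all_classical all_reals all_analysis.

Set Implicit Arguments.
Unset Strict Implicit.
Unset Printing Implicit Defensive.

Import Order.TTheory GRing.Theory Num.Theory.
Import numFieldNormedType.Exports.

Local Open Scope classical_set_scope.
Local Open Scope fset_scope.
Local Open Scope ring_scope.

Record fdist (R : realType) (T : choiceType) := FDist {
  fdist_fun :> {fsfun T -> R with 0};
  fdist_ge0 : forall x, 0 <= fdist_fun x;
  fdist_sum1 : \sum_(x <- finsupp fdist_fun) fdist_fun x = 1 }.

Section Ret.
Variables (R : realType) (T : choiceType) (x0 : T).

Definition ret_fun : {fsfun T -> R with 0} := [fsfun x in [fset x0] => 1 | 0].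

Lemma ret_funE x : ret_fun x = (x == x0)%:R.
Proof. by rewrite fsfun_fun inE; case: eqP. Qed.

Lemma finsupp_ret_fun : finsupp ret_fun = [fset x0].
Proof.
by apply/fsetP=> x; rewrite mem_finsupp ret_funE inE pnatr_eq0 eqb0 negbK.
Qed.

Lemma ret_ge0 x : 0 <= ret_fun x.
Proof. by rewrite ret_funE ler0n. Qed.

Lemma ret_sum1 : \sum_(x <- finsupp ret_fun) ret_fun x = 1.
Proof. by rewrite finsupp_ret_fun big_seq_fset1 ret_funE eqxx. Qed.

Definition fdist_ret : fdist R T := FDist ret_ge0 ret_sum1.

End Ret.

Section Bind.
Variables (R : realType) (T U : choiceType).
Variables (p : fdist R T) (f : T -> fdist R U).

Let supp : {fset U} := \bigcup_(x <- finsupp p) finsupp (f x).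

Definition bind_fun : {fsfun U -> R with 0} :=
  [fsfun y in supp => \sum_(x <- finsupp p) p x * f x y | 0].

Let subsupp x : x \in finsupp p -> finsupp (f x) `<=` supp.
Proof. by move=> xp; apply: bigfcup_sup. Qed.

Lemma bind_funE y : bind_fun y = \sum_(x <- finsupp p) p x * f x y.
Proof.
rewrite fsfun_fun; case: ifPn => // ys; rewrite big_seq big1// => x xp.
rewrite (fsfun_dflt (k := y)) ?mulr0 //; apply: contra ys.
exact: (fsubsetP (subsupp xp)).
Qed.

Lemma bind_ge0 y : 0 <= bind_fun y.
Proof.
by rewrite bind_funE; apply: sumr_ge0 => x _; apply: mulr_ge0; apply: fdist_ge0.
Qed.

Lemma bind_sum1 : \sum_(y <- finsupp bind_fun) bind_fun y = 1.
Proof.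
have sA : finsupp bind_fun `<=` supp.
  by apply/fsubsetP => y; apply: contraLR => ys; rewrite memNfinsupp fsfun_fun (negPf ys).
rewrite (big_fset_incl _ sA); last by move=> x _ xp; rewrite fsfun_dflt.
under eq_bigr => y _ do rewrite bind_funE.
rewrite exchange_big /= -(fdist_sum1 p) big_seq [RHS]big_seq.
apply: eq_bigr => x xp; rewrite -mulr_sumr -[RHS]mulr1; congr (_ * _).
rewrite -(fdist_sum1 (f x)) [RHS](big_fset_incl _ (subsupp xp)) //.
by move=> y _ yp; rewrite fsfun_dflt.
Qed.

Definition fdist_bind : fdist R U := FDist bind_ge0 bind_sum1.

Lemma mem_finsupp_bind y :
  y \in finsupp fdist_bind -> exists2 x, x \in finsupp p & y \in finsupp (f x).
Proof.
rewrite mem_finsupp /= bind_funE => ny0.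
have [[x xp yf]|nex] := pselect (exists2 x, x \in finsupp p & y \in finsupp (f x)).
  by exists x.
move: ny0; rewrite big_seq big1 ?eqxx// => x xp.
rewrite (fsfun_dflt (k := y)) ?mulr0 //; apply/negP => yf.
by apply: nex; exists x.
Qed.

End Bind.

Lemma mem_finsupp_ret (R : realType) (T : choiceType) (x y : T) :
  (y \in finsupp (fdist_ret R x)) = (y == x).
Proof. by rewrite /= finsupp_ret_fun inE. Qed.

Definition fdist_expect (R : realType) (T : choiceType) (p : fdist R T) (g : T -> R) : R :=
  \sum_(x <- finsupp p) p x * g x.

Definition fdist_entropy (R : realType) (T : choiceType) (p : fdist R T) : R :=
  \sum_(x <- finsupp p) - (p x * ln (p x)).

(* The alphabet is ['I_d.+1]: it has [d.+1] letters, so that it is not empty. *)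
Notation word d := (seq 'I_d.+1).

(* The set [finsupp (rs_law a)] is the set of realisations of the letter [a];
   it is finite, and non-empty since the probabilities sum to 1. *)
Record random_subst (R : realType) (d : nat) := RandomSubst {
  rs_law :> 'I_d.+1 -> fdist R (word d);
  rs_law_nonnil : forall a, [::] \notin finsupp (rs_law a) }.

Section RandomSubst.
Variables (R : realType) (d : nat).
Implicit Types (th : random_subst R d) (u v w : word d) (k n : nat).

(* concatenation of independent images of the letters of [u] *)
Fixpoint rs_apply th u : fdist R (word d) :=
  if u is a :: u' then
    fdist_bind (th a) (fun x => fdist_bind (rs_apply th u') (fun y => fdist_ret R (x ++ y)))
  else fdist_ret R [::].

(* law at time [n] of the Markov chain started from [u] *)
Definition rs_iter th n u : fdist R (word d) :=
  iter n (fun p => fdist_bind p (rs_apply th)) (fdist_ret R u).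

Definition rs_supp th n u : {fset word d} := finsupp (rs_iter th n u).

Lemma rs_apply_nonnil th u : u != [::] -> [::] \notin finsupp (rs_apply th u).
Proof.
case: u => //= a u _; apply/negP => /mem_finsupp_bind[x xa] /mem_finsupp_bind[y _].
rewrite mem_finsupp_ret; case: x xa => // xa _.
by move: (rs_law_nonnil th a); rewrite xa.
Qed.

Lemma rs_iter_nonnil th n u : u != [::] -> [::] \notin rs_supp th n u.
Proof.
move=> u0; rewrite /rs_supp; elim: n => [|n IH]; first by rewrite mem_finsupp_ret eq_sym.
apply/negP => /mem_finsupp_bind[v vn]; apply/negP/rs_apply_nonnil.
by apply: contraNneq IH => <-.
Qed.

Definition rs_pow th k : random_subst R d :=
  RandomSubst (fun a => rs_iter_nonnil th k (isT : [:: a] != [::])).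

(* number of (possibly overlapping) occurrences of [v] in [u] *)
Definition occ v u : nat := \sum_(i < size u) prefix v (drop i u).

(* column [j] describes the image of the letter [j] *)
Definition subst_mx th : 'M[R]_d.+1 :=
  \matrix_(i, j) fdist_expect (th j) (fun w => (occ [:: i] w)%:R).

Definition primitive_mx (M : 'M[R]_d.+1) : Prop :=
  (forall i j, 0 <= M i j) /\
  exists2 k, (0 < k)%N & forall i j, 0 < (M ^+ k) i j.

(* [eigenvalue] refers to row eigenvectors, but a matrix and its transpose have
   the same eigenvalues. *)
Definition PF_eigenvalue (M : 'M[R]_d.+1) (lambda : R) : Prop :=
  eigenvalue M lambda /\
  forall z : R[i], eigenvalue (map_mx (real_complex R) M) z -> `|z| <= (lambda%:C)%C.

Definition right_PF_eigenvector (M : 'M[R]_d.+1) (lambda : R) (r : 'cV[R]_d.+1) : Prop :=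
  [/\ M *m r = lambda *: r, forall i, 0 < r i ord0 & \sum_i r i ord0 = 1].

Definition primitive_subst th : Prop :=
  primitive_mx (subst_mx th) /\
  exists2 lambda, PF_eigenvalue (subst_mx th) lambda & 1 < lambda.

(* The empty word is included. *)
Definition language th : set (word d) :=
  [set w | exists a k u, [/\ (0 < k)%N, u \in rs_supp th k [:: a] & infix w u]].

Definition fullshift : Type := {ptws int -> discrete_topology 'I_d.+1}.
HB.instance Definition _ := Topological.on fullshift.
HB.instance Definition _ := isPointed.Build fullshift (fun=> ord0).

Definition borel_shift : Type := g_sigma_algebraType [set U : set fullshift | open U].
HB.instance Definition _ := Measurable.on borel_shift.

(* the factor of length [n] of [x] starting at position [i] *)
Definition factor (x : borel_shift) (i : int) (n : nat) : word d :=
  mkseq (fun j => x (i + j%:Z)) n.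

Definition left_shift (x : borel_shift) : borel_shift := fun i => x (i + 1).

Definition subshift th : set borel_shift :=
  [set x | forall i n, language th (factor x i n)].

(* A subset of [subshift th], so that the cylinder of a word outside the
   language is empty. *)
Definition cylinder th v : set borel_shift :=
  [set x | subshift th x /\ factor x 0 (size v) = v].

(* A Borel probability measure on the closed set [subshift th] is represented
   by a Borel probability measure on the full shift giving it mass 1. *)
Definition frequency_measure th (mu : probability borel_shift R) : Prop :=
  [/\ mu (subshift th) = 1%E,
      forall B, measurable B -> mu (left_shift @^-1` B) = mu B &
      forall v a, language th v ->
        (fun k => fdist_expect (rs_iter th k [:: a]) (fun w => (occ v w)%:R) /
                  fdist_expect (rs_iter th k [:: a]) (fun w => (size w)%:R))
          @ \oo --> fine (mu (cylinder th v))].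

(* The convention [0 * ln 0 = 0] holds since [ln 0 = 0]. *)
Definition measure_entropy th (mu : probability borel_shift R) : R :=
  limn (fun n => n%:R^-1 *
    \sum_(u : n.-tuple 'I_d.+1 | `[< language th u >])
      - (fine (mu (cylinder th u)) * ln (fine (mu (cylinder th u))))).

Definition entropy_vec th m : 'cV[R]_d.+1 :=
  \col_a fdist_entropy (rs_iter th m [:: a]).

(* [s] and [t] are families of realisations of the letters of [v]. *)
Definition unique_realisation_paths th : Prop :=
  forall n k v, (0 < n)%N -> (0 < k)%N -> language th v -> size v = n ->
  forall s t : seq (word d),
    all2 (fun a w => w \in rs_supp th k [:: a]) v s ->
    all2 (fun a w => w \in rs_supp th k [:: a]) v t ->
    flatten s = flatten t -> s = t.

Definition disjoint_set_condition th : Prop :=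
  forall a k u v, (0 < k)%N -> u \in finsupp (th a) -> v \in finsupp (th a) -> u != v ->
    rs_supp th k u `&` rs_supp th k v = fset0.

Definition identical_set_condition th : Prop :=
  forall a k u v, (0 < k)%N -> u \in finsupp (th a) -> v \in finsupp (th a) ->
    rs_supp th k u = rs_supp th k v.

Definition identical_production_probabilities th : Prop :=
  forall a k v u1 u2, (2 <= k)%N -> v \in rs_supp th k [:: a] ->
    u1 \in finsupp (th a) -> u2 \in finsupp (th a) ->
    rs_iter th k.-1 u1 v = rs_iter th k.-1 u2 v.

End RandomSubst.

(* Main.v *)
Require Import Defs.
From HB Require Import structures.
From mathcomp Require Import all_boot all_order all_algebra.
From mathcomp Require Import finmap complex.
From mathcomp Require Import all_classical all_reals all_analysis.
From mathcomp Require Import ring lra.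

Import Order.TTheory GRing.Theory Num.Theory.
Import numFieldNormedType.Exports.

Local Open Scope classical_set_scope.
Local Open Scope ring_scope.

(** Write [S k] for [lambda ^- k * HR k]. Everything follows from the identity
    [h = lim S k] together with two inequalities between levels of inflation
    words.

    Levels. The law of [theta^(k+m)(a)] is a two-step experiment: draw [u] from
    [theta^k(a)], then [theta^m(u)]. With unique realisation paths the images of
    the letters of [u] can be recovered from [theta^m(u)], so the entropy of
    [theta^m(u)] is the sum of [H_m] over the letters of [u]
    ([entropy_rs_iter]), and its mean, for a starting letter of law [r], is
    [lambda^k HR m]. The two bounds for the entropy of a two-step experiment give
    [lambda^k HR m <= HR (k + m) <= HR k + lambda^k HR m]. The first is an
    equality exactly when the law of [theta^m(u)] does not depend on [u]
    ([entropy_bind_ge_eq]), the second when distinct [u] have disjoint images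
    ([entropy_bind_le_eq]). Hence [S] is non-decreasing, and summing the second
    inequality along the multiples of [k] as a geometric series bounds [lim S] by
    [HR k / (lambda^k - 1)]. Either bound is attained in the limit exactly when
    every inequality used is an equality, which is what the disjoint and the
    identical set conditions of the [k]-th power say.

    Frequencies. Because [r] is a right eigenvector, the mean number of
    occurrences of a word at level [n], divided by [lambda^n], is non-decreasing
    in [n]; its limit is the measure [f v] of the cylinder. Thus [f] bounds the
    counts at every level, and passes to the limit in averages over sliding
    windows. Let [H_n] be the entropy of [f] on words of length [n].

    The identity [h = lim S k] is two applications of Gibbs inequality, each with
    a suitably chosen comparison measure.
    - Coding the inflation words of a high level letter by letter with the Markov
      chain of order [n] defined by [f] costs [H_(n+1) - H_n] per letter, so
      [S k <= H_(n+1) - H_n] and [n S k <= H_n] ([mean_entropy_le_chain],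
      [scaled_entropy_le_block]).
    - Conversely a window of length [n] of [theta^k(x)] is coded by the renewal
      measure whose blocks are level-[k] images of letters. The mean length of a
      block is [lambda^k] and its mean cost is [HR k + c] for a constant [c], so
      [H_n <= n (HR k + c) / lambda^k + C_k], where [C_k] pays for the blocks cut
      by the ends of the window ([block_entropy_le_renewal]).
    Dividing by [n] and letting first [n] and then [k] tend to infinity pinches
    [H_n / n] ([block_entropy_cvg]). *)

Set Implicit Arguments.
Unset Strict Implicit.
Unset Printing Implicit Defensive.

(** * Finitely supported laws *)

Section Expectation.
Variable R : realType.
Implicit Types T U : choiceType.
Local Notation E := fdist_expect.

Lemma expect_sub T (p : fdist R T) (A : {fset T}) g :
  (finsupp p `<=` A)%fset -> E p g = \sum_(x <- A) p x * g x.
Proof.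
move=> pA; rewrite /fdist_expect (big_fset_incl _ pA) // => x _ xp.
by rewrite fsfun_dflt // mul0r.
Qed.

Lemma expect_ret T (x : T) g : E (fdist_ret R x) g = g x.
Proof.
by rewrite /fdist_expect finsupp_ret_fun big_seq_fset1 ret_funE eqxx mul1r.
Qed.

Lemma eq_expect T (p : fdist R T) g h :
  (forall x, x \in finsupp p -> g x = h x) -> E p g = E p h.
Proof. by move=> gh; apply: eq_big_seq => x /gh ->. Qed.

Lemma expect_bind T U (p : fdist R T) (f : T -> fdist R U) g :
  E (fdist_bind p f) g = E p (fun x => E (f x) g).
Proof.
pose A := (\bigcup_(x <- finsupp p) finsupp (f x))%fset.
have fA x : x \in finsupp p -> (finsupp (f x) `<=` A)%fset.
  by move=> xp; apply: bigfcup_sup.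
have bA : (finsupp (fdist_bind p f) `<=` A)%fset.
  apply/fsubsetP => y /mem_finsupp_bind[x xp yx].
  exact: (fsubsetP (fA _ xp)).
rewrite (expect_sub _ bA).
under eq_bigr => y _ do rewrite /= bind_funE mulr_suml.
rewrite exchange_big; apply: eq_big_seq => x xp /=.
rewrite (expect_sub _ (fA _ xp)) mulr_sumr.
by apply: eq_bigr => y _; rewrite mulrA.
Qed.

Lemma fdistE T (p : fdist R T) x : p x = E p (fun y => (y == x)%:R).
Proof.
have pA : (finsupp p `<=` x |` finsupp p)%fset by apply: fsubsetU1.
rewrite (expect_sub _ pA) (big_fsetD1 x) ?fset1U1 //= eqxx mulr1 big_seq big1 ?addr0 //.
by move=> y; rewrite !inE => /andP[/negPf-> _]; rewrite mulr0.
Qed.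

Lemma fdist_ext T (p q : fdist R T) : (forall x, p x = q x) -> p = q.
Proof.
case: p q => [p p0 p1] [q q0 q1] /= /fsfunP pq; move: q0 q1; rewrite -{}pq => q0 q1.
by rewrite (Prop_irrelevance p0 q0) (Prop_irrelevance p1 q1).
Qed.

(** Expectations separate laws, so that the monad laws and the commutation of
    independent draws reduce to identities between iterated sums. *)
Lemma eq_fdist T (p q : fdist R T) : (forall g, E p g = E q g) -> p = q.
Proof. by move=> pq; apply: fdist_ext => x; rewrite !fdistE pq. Qed.

Lemma bindA T U V (p : fdist R T) (f : T -> fdist R U) (g : U -> fdist R V) :
  fdist_bind (fdist_bind p f) g = fdist_bind p (fun x => fdist_bind (f x) g).
Proof.
by apply: eq_fdist => h; rewrite !expect_bind; apply: eq_expect => x _; rewrite expect_bind.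
Qed.

Lemma bind_retl T U x (f : T -> fdist R U) : fdist_bind (fdist_ret R x) f = f x.
Proof. by apply: eq_fdist => h; rewrite expect_bind expect_ret. Qed.

Lemma bind_retr T (p : fdist R T) : fdist_bind p (fdist_ret R (T:=T)) = p.
Proof.
by apply: eq_fdist => h; rewrite expect_bind; apply: eq_expect => x _; rewrite expect_ret.
Qed.

Lemma expectC T U (p : fdist R T) (q : fdist R U) g :
  E p (fun x => E q (fun y => g x y)) = E q (fun y => E p (fun x => g x y)).
Proof.
rewrite /fdist_expect; under eq_bigr do rewrite mulr_sumr.
rewrite exchange_big; apply: eq_bigr => y _; rewrite mulr_sumr.
by apply: eq_bigr => x _; rewrite mulrCA.
Qed.

Lemma expect_cst T (p : fdist R T) c : E p (fun=> c) = c.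
Proof. by rewrite /fdist_expect -mulr_suml fdist_sum1 mul1r. Qed.

Lemma expectD T (p : fdist R T) g h : E p (fun x => g x + h x) = E p g + E p h.
Proof. by rewrite -big_split; apply: eq_bigr => x _; rewrite mulrDr. Qed.

Lemma expectZ T (p : fdist R T) c g : E p (fun x => c * g x) = c * E p g.
Proof. by rewrite mulr_sumr; apply: eq_bigr => x _; rewrite mulrCA. Qed.

Lemma expectB T (p : fdist R T) g h : E p (fun x => g x - h x) = E p g - E p h.
Proof. by rewrite -sumrB; apply: eq_bigr => x _; rewrite mulrBr. Qed.

Lemma expect_sum T (p : fdist R T) (I : finType) (F : I -> T -> R) :
  E p (fun x => \sum_i F i x) = \sum_i E p (F i).
Proof.
by rewrite exchange_big; apply: eq_bigr => x _; rewrite -mulr_sumr.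
Qed.

Lemma le_expect T (p : fdist R T) g h :
  (forall x, x \in finsupp p -> g x <= h x) -> E p g <= E p h.
Proof.
move=> gh; rewrite /fdist_expect big_seq [leRHS]big_seq.
by apply: ler_sum => x /gh; apply: ler_wpM2l; apply: fdist_ge0.
Qed.

Lemma expect_ge0 T (p : fdist R T) g :
  (forall x, x \in finsupp p -> 0 <= g x) -> 0 <= E p g.
Proof. by move=> g0; rewrite -[leLHS](expect_cst p); apply: le_expect. Qed.

Lemma fdist_gt0 T (p : fdist R T) x : (0 < p x) = (x \in finsupp p).
Proof. by rewrite lt_neqAle fdist_ge0 andbT eq_sym mem_finsupp. Qed.

Lemma expect_eq0 T (p : fdist R T) g :
  (forall x, x \in finsupp p -> 0 <= g x) -> E p g = 0 ->
  forall x, x \in finsupp p -> g x = 0.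
Proof.
move=> g0 /eqP; rewrite /fdist_expect big_seq psumr_eq0; last first.
  by move=> x /g0; apply: mulr_ge0; apply: fdist_ge0.
move=> /allP h x xp; move: (h x xp); rewrite xp /= mulf_eq0.
by rewrite gt_eqF ?fdist_gt0 //= => /eqP.
Qed.

Lemma bindE T U (p : fdist R T) (f : T -> fdist R U) y :
  fdist_bind p f y = E p (fun x => f x y).
Proof. by rewrite /= bind_funE. Qed.

Lemma mem_bind T U (p : fdist R T) (f : T -> fdist R U) x y :
  x \in finsupp p -> y \in finsupp (f x) -> y \in finsupp (fdist_bind p f).
Proof.
rewrite -!fdist_gt0 bindE => xp yx; rewrite lt_neqAle expect_ge0 ?andbT; last first.
  by move=> z _; apply: fdist_ge0.
apply/negP => /eqP /esym /expect_eq0 h.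
by move: yx; rewrite h ?ltxx // => [z _|]; rewrite ?fdist_ge0 // -fdist_gt0.
Qed.

Lemma fdist_le1 T (p : fdist R T) x : p x <= 1.
Proof.
rewrite fdistE -[leRHS](expect_cst p); apply: le_expect => y _.
by rewrite lern1 leq_b1.
Qed.

End Expectation.

(** * Entropy of a two-step experiment *)

Section Entropy.
Variable R : realType.
Implicit Types T U : choiceType.
Local Notation E := fdist_expect.
Local Notation H := (@fdist_entropy R _).

Lemma entropyE T (p : fdist R T) : H p = E p (fun x => - ln (p x)).
Proof. by apply: eq_bigr => x _; rewrite mulrN. Qed.

Lemma entropy_ge0 T (p : fdist R T) : 0 <= H p.
Proof.
by rewrite entropyE; apply: expect_ge0 => x _; rewrite oppr_ge0 ln_le0 // fdist_le1.
Qed.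

Lemma entropy_ret T (x : T) : H (fdist_ret R x) = 0.
Proof. by rewrite entropyE expect_ret /= ret_funE eqxx ln1 oppr0. Qed.

Lemma ln_leB1 (x : R) : 0 < x -> ln x <= x - 1.
Proof.
move=> x0; have := @le_ln1Dx R (x - 1); rewrite (_ : 1 + (x - 1) = x); last by ring.
by apply; rewrite ltrBrDl subrr.
Qed.

Lemma ln_ltB1 (x : R) : 0 < x -> x != 1 -> ln x < x - 1.
Proof.
move=> x0 x1; have := @expR_gt1Dx R (ln x); rewrite ln_eq0 // x1 lnK ?posrE //.
by move=> /(_ isT); lra.
Qed.

(** Gibbs inequality, one term at a time; summing over a support compares an
    entropy with the cross-entropy against any positive weight. *)
Lemma gibbs_term (s t : R) : 0 <= s -> 0 < t -> - (s * ln s) <= - (s * ln t) + t - s.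
Proof.
rewrite le_eqVlt => /predU1P[<- t0|s0 t0]; first by rewrite !mul0r; lra.
have := @ln_leB1 (t / s) (divr_gt0 t0 s0); rewrite ln_div ?posrE // => h.
have : s * (ln t - ln s) <= s * (t / s - 1) by rewrite ler_pM2l.
rewrite mulrBr (mulrBr s (t / s)) mulr1 mulrCA divff ?gt_eqF // mulr1; lra.
Qed.

Lemma gibbs_term_eq (s t : R) : 0 <= s -> 0 < t ->
  - (s * ln s) = - (s * ln t) + t - s -> s = t.
Proof.
rewrite le_eqVlt => /predU1P[<- t0|s0 t0].
  by rewrite !mul0r; lra.
move=> e; apply/eqP; apply: contraT => st.
have := @ln_ltB1 (t / s) (divr_gt0 t0 s0); rewrite ln_div ?posrE //.
have -> : t / s != 1.
  by apply: contra st => /eqP h; rewrite -[t](divfK (lt0r_neq0 s0)) h mul1r.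
move=> /(_ isT) h.
have : s * (ln t - ln s) < s * (t / s - 1) by rewrite ltr_pM2l.
rewrite mulrBr (mulrBr s (t / s)) mulr1 mulrCA divff ?gt_eqF // mulr1; lra.
Qed.

Lemma gibbs T (p : fdist R T) (q : T -> R) :
  (forall x, x \in finsupp p -> 0 < q x) ->
  H p <= E p (fun x => - ln (q x)) + \sum_(x <- finsupp p) q x - 1.
Proof.
move=> q0; rewrite -[X in _ - X](fdist_sum1 p) /fdist_entropy /fdist_expect.
rewrite -addrA -sumrB -big_split /= big_seq [leRHS]big_seq.
apply: ler_sum => x xp; rewrite mulrN addrA.
by apply: gibbs_term; rewrite ?fdist_ge0 ?q0.
Qed.

Lemma psum_seq_eq0 (T : eqType) (s : seq T) (F : T -> R) :
  \sum_(y <- s) F y = 0 -> (forall y, y \in s -> 0 <= F y) ->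
  forall y, y \in s -> F y = 0.
Proof.
move=> /eqP e F0 y ys; move: e; rewrite big_seq psumr_eq0; last exact: F0.
by move=> /allP/(_ y ys); rewrite ys => /eqP.
Qed.

Section Bind.
Variables (T U : choiceType) (p : fdist R T) (K : T -> fdist R U).
Let q := fdist_bind p K.

Let qE g : E q g = E p (fun x => E (K x) g).
Proof. exact: expect_bind. Qed.

Let memq x y : x \in finsupp p -> y \in finsupp (K x) -> y \in finsupp q.
Proof. exact: mem_bind. Qed.

(* The Kullback-Leibler divergence of [K x] from [q], written with the extra
   terms of total sum zero that make every summand non-negative. *)
Let gap_term x y := - (K x y * ln (q y)) + q y - K x y + K x y * ln (K x y).

Let gap_term_ge0 x y : y \in finsupp q -> 0 <= gap_term x y.
Proof.
move=> yq; rewrite /gap_term; have := @gibbs_term (K x y) (q y).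
by rewrite fdist_ge0 fdist_gt0 yq => /(_ isT isT); lra.
Qed.

Let gapE : H q - E p (fun x => H (K x)) = E p (fun x => \sum_(y <- finsupp q) gap_term x y).
Proof.
rewrite entropyE qE -expectB; apply: eq_expect => x xp.
have sub : (finsupp (K x) `<=` finsupp q)%fset by apply/fsubsetP => y; apply: memq.
rewrite (expect_sub _ sub) entropyE (expect_sub _ sub) -sumrB /=.
have K1 : \sum_(y <- finsupp q) K x y = 1.
  by rewrite -(expect_cst (K x) 1) (expect_sub _ sub); apply: eq_bigr => y _; rewrite mulr1.
have h0 : 0 = \sum_(y <- finsupp q) q y - \sum_(y <- finsupp q) K x y.
  by rewrite fdist_sum1 K1 subrr.
rewrite -[LHS]addr0 [X in _ + X = _]h0 -sumrB -big_split.
by apply: eq_bigr => y _ /=; rewrite /gap_term; ring.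
Qed.

Let sum_gap_ge0 x : 0 <= \sum_(y <- finsupp q) gap_term x y.
Proof. by rewrite big_seq; apply: sumr_ge0 => y; apply: gap_term_ge0. Qed.

(** Conditioning on the first stage lowers the entropy. The gap is the mean
    Kullback-Leibler divergence of [K x] from the law of the outcome, so it
    vanishes only if every [K x] is that law. *)
Lemma entropy_bind_ge : E p (fun x => H (K x)) <= H q.
Proof. by rewrite -subr_ge0 gapE; apply: expect_ge0. Qed.

Lemma entropy_bind_ge_eq :
  E p (fun x => H (K x)) = H q <->
  (forall x x', x \in finsupp p -> x' \in finsupp p -> K x = K x').
Proof.
split=> [e|Kc].
  suff Kq x : x \in finsupp p -> K x = q by move=> x x' /Kq -> /Kq ->.
  move=> xp; have : H q - E p (fun x => H (K x)) = 0 by rewrite e subrr.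
  rewrite gapE => /expect_eq0 h; have {h} := h (fun x _ => sum_gap_ge0 x) _ xp.
  move=> /psum_seq_eq0 h; have {}h := h (fun y => @gap_term_ge0 x y).
  apply: fdist_ext => y; case: (boolP (y \in finsupp q)) => yq; last first.
    rewrite (fsfun_dflt yq) fsfun_dflt //; apply: contra yq; exact: memq.
  apply: gibbs_term_eq; rewrite ?fdist_ge0 ?fdist_gt0 //.
  by move: (h _ yq); rewrite /gap_term; lra.
apply/eqP; rewrite eq_sym -subr_eq0 gapE; apply/eqP.
rewrite -[RHS](expect_cst p); apply: eq_expect => x xp; apply: big1 => y _.
rewrite /gap_term; suff -> : q y = K x y by lra.
by rewrite bindE -[RHS](expect_cst p); apply: eq_expect => x' xp'; rewrite (Kc x' x).
Qed.

(** The deficit in [H q <= H p + E H(K)] is the mean of [ln (q y / (p x K x y))]: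
    it vanishes exactly when each outcome comes from a single [x]. *)
Let deficitE : H p + E p (fun x => H (K x)) - H q =
  E p (fun x => E (K x) (fun y => ln (q y) - ln (p x * K x y))).
Proof.
rewrite entropyE [H q]entropyE qE -expectD -expectB.
apply: eq_expect => x xp; rewrite entropyE.
rewrite -[X in X + _ - _](expect_cst (K x)) -expectD -expectB.
apply: eq_expect => y yx; rewrite lnM ?posrE ?fdist_gt0 //; lra.
Qed.

Let joint_le x y : p x * K x y <= q y.
Proof.
case: (boolP (x \in finsupp p)) => xp; last first.
  by rewrite (fsfun_dflt xp) mul0r fdist_ge0.
rewrite /q /= bind_funE (big_fsetD1 x) //= lerDl.
by apply: sumr_ge0 => z _; rewrite mulr_ge0 ?fdist_ge0.
Qed.

Let deficit_ge0 x y : x \in finsupp p -> y \in finsupp (K x) ->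
  0 <= ln (q y) - ln (p x * K x y).
Proof.
move=> xp yx; rewrite subr_ge0 ler_ln ?joint_le // posrE ?mulr_gt0 ?fdist_gt0 //.
exact: memq yx.
Qed.

Lemma entropy_bind_le : H q <= H p + E p (fun x => H (K x)).
Proof.
rewrite -subr_ge0 deficitE; apply: expect_ge0 => x xp; apply: expect_ge0 => y.
exact: deficit_ge0.
Qed.

Lemma entropy_bind_le_eq :
  H q = H p + E p (fun x => H (K x)) <->
  (forall x x', x \in finsupp p -> x' \in finsupp p -> x != x' ->
    (finsupp (K x) `&` finsupp (K x') = fset0)%fset).
Proof.
have -> : (H q = H p + E p (fun x => H (K x))) <->
    (E p (fun x => E (K x) (fun y => ln (q y) - ln (p x * K x y))) = 0).
  by rewrite -deficitE; split=> [->|/subr0_eq ->] //; rewrite subrr.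
split=> [e x x' xp xp' xx'|disj].
  apply/eqP; rewrite -fsubset0; apply/fsubsetP => y; rewrite inE => /andP[yx yx'].
  have /expect_eq0 h := expect_eq0 (fun x xp => expect_ge0 (fun y => deficit_ge0 xp)) e xp.
  have {h} /subr0_eq e1 := h (fun y => deficit_ge0 xp) _ yx.
  have /ln_inj : ln (q y) = ln (p x * K x y) by [].
  rewrite !posrE mulr_gt0 ?fdist_gt0 ?(memq xp) // => /(_ isT isT).
  rewrite /q /= bind_funE (big_fsetD1 x) //= (big_fsetD1 x') ?inE ?xp' ?andbT 1?eq_sym //=.
  have : 0 < p x' * K x' y by rewrite mulr_gt0 ?fdist_gt0.
  set s := \sum_(_ <- _) _; suff : 0 <= s by lra.
  by apply: sumr_ge0 => z _; rewrite mulr_ge0 ?fdist_ge0.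
rewrite -[RHS](expect_cst p); apply: eq_expect => x xp.
rewrite -[RHS](expect_cst (K x)); apply: eq_expect => y yx.
suff -> : q y = p x * K x y by rewrite subrr.
rewrite /q /= bind_funE (big_fsetD1 x) //= big_seq big1 ?addr0 // => z.
rewrite !inE => /andP[zx zp]; rewrite (fsfun_dflt (k := y)) ?mulr0 //.
apply/negP => yz; have /fsetP/(_ y) := disj _ _ zp xp zx.
by rewrite !inE yz yx.
Qed.

End Bind.
End Entropy.

(** * Iterating a random substitution *)

Section Iterate.
Variables (R : realType) (d : nat).
Implicit Types (th : random_subst R d) (u v w : word d).
Local Notation E := fdist_expect.

Definition cat_law (p q : fdist R (word d)) : fdist R (word d) :=
  fdist_bind p (fun x => fdist_bind q (fun y => fdist_ret R (x ++ y))).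

Lemma expect_cat_law p q g :
  E (cat_law p q) g = E p (fun x => E q (fun y => g (x ++ y))).
Proof.
rewrite expect_bind; apply: eq_expect => x _; rewrite expect_bind.
by apply: eq_expect => y _; rewrite expect_ret.
Qed.

Lemma cat_lawA p q s : cat_law (cat_law p q) s = cat_law p (cat_law q s).
Proof.
apply: eq_fdist => g; rewrite !expect_cat_law; apply: eq_expect => x _.
rewrite expect_cat_law; apply: eq_expect => y _.
by apply: eq_expect => z _; rewrite catA.
Qed.

Lemma mem_cat_law p q w : w \in finsupp (cat_law p q) ->
  exists x y, [/\ x \in finsupp p, y \in finsupp q & w = x ++ y].
Proof.
case/mem_finsupp_bind => x xp /mem_finsupp_bind[y yq].
by rewrite mem_finsupp_ret => /eqP ->; exists x, y.
Qed.

Lemma rs_apply_cat th u v :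
  rs_apply th (u ++ v) = cat_law (rs_apply th u) (rs_apply th v).
Proof.
elim: u => [|a u IH]; first by rewrite /= /cat_law bind_retl bind_retr.
rewrite /= -!/(cat_law _ _) IH; exact/esym/cat_lawA.
Qed.

Lemma rs_apply1 th a : rs_apply th [:: a] = th a.
Proof.
rewrite /= -[RHS](bind_retr); congr fdist_bind; apply: funext => x.
by rewrite bind_retl cats0.
Qed.

Lemma rs_iterS th n u :
  rs_iter th n.+1 u = fdist_bind (rs_iter th n u) (rs_apply th).
Proof. by []. Qed.

Lemma rs_iterD th m n u :
  rs_iter th (m + n) u = fdist_bind (rs_iter th m u) (rs_iter th n).
Proof.
elim: n => [|n IH]; first by rewrite addn0 -[LHS]bind_retr.
by rewrite addnS !rs_iterS IH bindA.
Qed.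

(** The letters of a word evolve independently for any number of steps: one
    step acts on the two factors separately, and the draws commute. *)
Lemma rs_iter_cat th n u v :
  rs_iter th n (u ++ v) = cat_law (rs_iter th n u) (rs_iter th n v).
Proof.
elim: n => [|n IH]; first by rewrite /cat_law /rs_iter /= !bind_retl.
rewrite !rs_iterS IH; apply: eq_fdist => g.
rewrite expect_bind !expect_cat_law expect_bind; apply: eq_expect => x _.
under eq_expect do rewrite rs_apply_cat expect_cat_law.
rewrite expectC; apply: eq_expect => x' _.
by rewrite expect_bind.
Qed.

Lemma rs_iter_nil th n : rs_iter th n [::] = fdist_ret R [::].
Proof. by elim: n => [//|n IH]; rewrite rs_iterS IH bind_retl. Qed.

Lemma rs_iter_cons th n a u :
  rs_iter th n (a :: u) = cat_law (rs_iter th n [:: a]) (rs_iter th n u).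
Proof. by rewrite -rs_iter_cat. Qed.

Lemma rs_apply_pow th k u : rs_apply (rs_pow th k) u = rs_iter th k u.
Proof.
elim: u => [|a u IH]; first by rewrite rs_iter_nil.
by rewrite rs_iter_cons /= IH.
Qed.

Lemma rs_iter_pow th k j u : rs_iter (rs_pow th k) j u = rs_iter th (j * k) u.
Proof.
elim: j => [//|j IH]; rewrite rs_iterS IH mulSn addnC rs_iterD.
by congr fdist_bind; apply: funext => v; rewrite rs_apply_pow.
Qed.

Definition letter_sum (psi : 'I_d.+1 -> R) w := \sum_(b <- w) psi b.

Lemma letter_sum_cat psi u v :
  letter_sum psi (u ++ v) = letter_sum psi u + letter_sum psi v.
Proof. by rewrite /letter_sum big_cat. Qed.

Lemma letter_sum_cons psi a u : letter_sum psi (a :: u) = psi a + letter_sum psi u.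
Proof. by rewrite /letter_sum big_cons. Qed.

Lemma expect_letter_sum th n psi u :
  E (rs_iter th n u) (letter_sum psi) =
  letter_sum (fun b => E (rs_iter th n [:: b]) (letter_sum psi)) u.
Proof.
elim: u => [|a u IH]; first by rewrite rs_iter_nil expect_ret /letter_sum !big_nil.
rewrite letter_sum_cons -IH rs_iter_cons expect_cat_law.
under eq_expect => x _ do under eq_expect => y _ do rewrite letter_sum_cat.
under eq_expect => x _ do rewrite expectD expect_cst.
by rewrite expectD expect_cst.
Qed.

(** * Occurrences and windows *)

Lemma occ_nil v : occ v [::] = 0%N.
Proof. by rewrite /occ big_ord0. Qed.

Lemma occ_cons v b u : occ v (b :: u) = (prefix v (b :: u) + occ v u)%N.
Proof. by rewrite /occ /= big_ord_recl. Qed.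

Lemma occ0 u : occ [::] u = size u.
Proof. by elim: u => [|b u IH]; rewrite ?occ_nil // occ_cons IH prefix0s. Qed.

Lemma occ1 b u : (occ [:: b] u)%:R = letter_sum (fun a => (a == b)%:R) u :> R.
Proof.
elim: u => [|a u IH]; first by rewrite occ_nil /letter_sum big_nil.
by rewrite occ_cons letter_sum_cons natrD IH prefix_cons prefix0s andbT eq_sym.
Qed.

Lemma occ_cat v x y : (occ v x + occ v y <= occ v (x ++ y))%N.
Proof.
elim: x => [|b x IH]; first by rewrite occ_nil.
rewrite cat_cons !occ_cons -addnA leq_add //.
case: (boolP (prefix v (b :: x))) => // /prefix_trans h.
by rewrite h // -cat_cons prefix_prefix.
Qed.

Lemma occ_gt0 v x y : v != [::] -> (0 < occ v (x ++ v ++ y))%N.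
Proof.
move=> v0; elim: x => [|b x IH]; last by rewrite cat_cons occ_cons addn_gt0 IH orbT.
case: v v0 => // a v _; rewrite cat0s cat_cons occ_cons -cat_cons.
by rewrite prefix_prefix.
Qed.

(** Only an occurrence at the start of [u] has no letter before it. *)
Lemma occ_extend_left v u : v != [::] ->
  occ v u = (prefix v u + \sum_(b < d.+1) occ (b :: v) u)%N.
Proof.
move=> v0; elim: u => [|a u IH].
  rewrite occ_nil big1 ?addn0; last by move=> *; rewrite occ_nil.
  by case: v v0.
rewrite occ_cons IH; congr addn.
under [RHS]eq_bigr do rewrite occ_cons prefix_cons.
rewrite [RHS]big_split /=; congr addn.
by rewrite (bigD1 a) //= eqxx big1 ?addn0 // => b /negPf ->.
Qed.

Lemma occ_extend_left0 u : size u = (\sum_(b < d.+1) occ [:: b] u)%N.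
Proof.
elim: u => [|a u IH]; first by rewrite big1 // => b _; rewrite occ_nil.
under eq_bigr do rewrite occ_cons prefix_cons prefix0s andbT.
by rewrite big_split /= -IH (bigD1 a) //= eqxx big1 // => b /negPf ->.
Qed.

(** Letting windows slide over a word counts its factors: this turns sums of
    costs along random words into averages against factor frequencies. *)
Fixpoint window_sum n (kap : word d -> R) w : R :=
  if w is _ :: w' then
    (if (n <= size w)%N then kap (take n w) else 0) + window_sum n kap w'
  else 0.

Lemma window_sum_occ n kap w : (0 < n)%N ->
  window_sum n kap w = \sum_(v : n.-tuple 'I_d.+1) (occ v w)%:R * kap v.
Proof.
move=> n0; elim: w => [|b w IH]; first by rewrite big1 // => v _; rewrite occ_nil mul0r.
under eq_bigr do rewrite occ_cons natrD mulrDl.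
rewrite big_split -IH [LHS]/=; congr (_ + _).
case: ifPn => [nw|nw].
  have st : size (take n (b :: w)) == n by rewrite size_takel.
  have pt : prefix (Tuple st) (b :: w) := prefix_take _ _.
  rewrite (bigD1 (Tuple st)) // pt mul1r big1 => [|v]; first by rewrite /= addr0.
  rewrite andTb.
  apply: contraNeq; rewrite mulf_eq0 negb_or pnatr_eq0 eqb0 negbK => /andP[pv _].
  by apply/eqP/val_inj => /=; move: pv; rewrite prefixE size_tuple => /eqP.
rewrite big1 // => v _; case: (boolP (prefix v _)); last by rewrite mul0r.
by move=> /size_prefix; rewrite size_tuple /= (negPf nw).
Qed.

End Iterate.

(** * Sums over the words of a given length *)

Section WordSum.
Variables (R : realType) (d : nat).
Implicit Types (u v w : word d) (F G : word d -> R).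
Local Notation E := fdist_expect.

(** The recursive form, unlike a sum over tuples, splits words into a prefix and
    a suffix without casts. *)
Fixpoint word_sum n F : R :=
  if n is n'.+1 then \sum_(b < d.+1) word_sum n' (fun w => F (b :: w)) else F [::].

Lemma word_sumE n F : word_sum n F = \sum_(t : n.-tuple 'I_d.+1) F t.
Proof.
elim: n F => [|n IH] F /=.
  rewrite (bigD1 [tuple]) //= big1 ?addr0 // => t /negP[].
  by apply/eqP/val_inj; case: t => -[].
under eq_bigr do rewrite IH.
rewrite pair_big /= (reindex (fun p : 'I_d.+1 * n.-tuple 'I_d.+1 =>
  [tuple of p.1 :: p.2])) //=.
exists (fun t : n.+1.-tuple 'I_d.+1 => (thead t, [tuple of behead t])) => [[b t] _|t _].
  by congr pair; apply: val_inj.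
by rewrite /= -tuple_eta.
Qed.

Lemma eq_word_sum n F G : (forall w, size w = n -> F w = G w) ->
  word_sum n F = word_sum n G.
Proof.
by move=> FG; rewrite !word_sumE; apply: eq_bigr => t _; rewrite FG // size_tuple.
Qed.

Lemma le_word_sum n F G : (forall w, size w = n -> F w <= G w) ->
  word_sum n F <= word_sum n G.
Proof.
by move=> FG; rewrite !word_sumE; apply: ler_sum => t _; rewrite FG // size_tuple.
Qed.

Lemma word_sumD n F G :
  word_sum n (fun w => F w + G w) = word_sum n F + word_sum n G.
Proof. by rewrite !word_sumE -big_split. Qed.

Lemma word_sumB n F G :
  word_sum n (fun w => F w - G w) = word_sum n F - word_sum n G.
Proof. by rewrite !word_sumE -sumrB. Qed.

Lemma word_sumZ n c F : word_sum n (fun w => c * F w) = c * word_sum n F.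
Proof. by rewrite !word_sumE mulr_sumr. Qed.

Lemma word_sum_sum n I (s : seq I) (F : I -> word d -> R) :
  word_sum n (fun w => \sum_(i <- s) F i w) = \sum_(i <- s) word_sum n (F i).
Proof.
by rewrite word_sumE exchange_big; apply: eq_bigr => i _; rewrite word_sumE.
Qed.

Lemma word_sum_cat m n F :
  word_sum (m + n) F = word_sum m (fun u => word_sum n (fun v => F (u ++ v))).
Proof. by elim: m F => //= m IH F; apply: eq_bigr => b _; rewrite IH. Qed.

Lemma word_sumSr n F :
  word_sum n.+1 F = word_sum n (fun w => \sum_(b < d.+1) F (b :: w)).
Proof. by rewrite word_sum_sum. Qed.

Lemma cvg_word_sum n (F : nat -> word d -> R) G :
  (forall w, F N w @[N --> \oo] --> G w) ->
  word_sum n (F N) @[N --> \oo] --> word_sum n G.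
Proof.
elim: n F G => [|n IH] F G FG /=; first exact: FG.
apply: cvg_big => [|i _]; first exact: add_continuous.
exact: IH.
Qed.

Lemma word_sum_delta n u F :
  word_sum n (fun w => (w == u)%:R * F w) = (size u == n)%:R * F u.
Proof.
rewrite word_sumE; case: (boolP (size u == n)) => [su|su]; last first.
  rewrite mul0r big1 // => t _; case: eqP => [tu|]; rewrite ?mul0r //.
  by rewrite -tu size_tuple eqxx in su.
rewrite (bigD1 (Tuple su)) //= eqxx big1 ?addr0 // => t tu.
by rewrite (_ : (tval t == u) = false) ?mul0r //; apply: negbTE.
Qed.

Lemma sum_size_lt B m (c : R) : (m < B)%N -> \sum_(j < B) (m == j)%:R * c = c.
Proof.
move=> mB; rewrite (bigD1 (Ordinal mB)) //= eqxx mul1r big1 ?addr0 // => j jm.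
by rewrite (_ : (m == j) = false) ?mul0r //; apply: contraNF jm => /eqP mj; apply/eqP/val_inj.
Qed.

Lemma le_sum_word_sum (s : seq (word d)) B F : uniq s ->
  (forall w, w \in s -> (size w < B)%N) -> (forall w, 0 <= F w) ->
  \sum_(w <- s) F w <= \sum_(j < B) word_sum j F.
Proof.
move=> us sB F0.
have -> : \sum_(w <- s) F w =
    \sum_(j < B) word_sum j (fun t => (t \in s)%:R * F t).
  transitivity (\sum_(w <- s) \sum_(j < B) word_sum j (fun t => (t == w)%:R * F t)).
    apply: eq_big_seq => w /sB wB; under eq_bigr do rewrite word_sum_delta.
    by rewrite sum_size_lt.
  rewrite exchange_big; apply: eq_bigr => j _; rewrite -word_sum_sum.
  apply: eq_word_sum => t _; rewrite -mulr_suml; congr (_ * _).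
  rewrite -count_uniq_mem // -sum1_count natr_sum [RHS]big_mkcond.
  by apply: eq_bigr => w _; rewrite /= eq_sym; case: (_ == _).
by apply: ler_sum => j _; apply: le_word_sum => t _; rewrite ler_piMl // lern1 leq_b1.
Qed.

Lemma fdist_word_sum_le1 (p : fdist R (word d)) B :
  \sum_(j < B) word_sum j p <= 1.
Proof.
have -> : \sum_(j < B) word_sum j p =
    E p (fun u => \sum_(j < B) word_sum j (fun t => (t == u)%:R)).
  rewrite expect_sum; apply: eq_bigr => j _; rewrite /fdist_expect.
  transitivity (word_sum j (fun t => \sum_(u <- finsupp p) p u * (t == u)%:R)).
    apply: eq_word_sum => t _; rewrite fdistE; apply: eq_bigr => u _.
    by rewrite eq_sym.
  by rewrite word_sum_sum; apply: eq_bigr => u _; rewrite word_sumZ.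
rewrite -[leRHS](expect_cst p); apply: le_expect => u _.
rewrite (_ : \sum_(j < B) _ = \sum_(j < B) (size u == j)%:R * 1); last first.
  apply: eq_bigr => j _; rewrite -word_sum_delta.
  by apply: eq_word_sum => t _; rewrite mulr1.
case: (ltnP (size u) B) => uB; first by rewrite sum_size_lt.
rewrite big1 // => j _; rewrite (_ : (size u == j) = false) ?mul0r //.
by rewrite gtn_eqF // (leq_trans (ltn_ord j)).
Qed.

End WordSum.

(** * Iterating from a random letter *)

Section Mean.
Variables (R : realType) (d : nat) (th : random_subst R d) (r : 'cV[R]_d.+1).
Implicit Types (u v w : word d) (phi : word d -> R).
Local Notation E := fdist_expect.

(** When [r] is the right Perron-Frobenius vector, drawing the starting letter
    with law [r] makes all letter statistics grow by exactly [lambda] at each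
    step, without error terms. *)
Definition mean n phi : R := \sum_a r a ord0 * E (rs_iter th n [:: a]) phi.

Hypothesis r0 : forall a, 0 < r a ord0.
Hypothesis r1 : \sum_a r a ord0 = 1.

Lemma le_mean n phi psi :
  (forall a w, w \in rs_supp th n [:: a] -> phi w <= psi w) ->
  mean n phi <= mean n psi.
Proof.
move=> h; apply: ler_sum => a _; rewrite ler_pM2l //.
by apply: le_expect => w; apply: h.
Qed.

Lemma eq_mean n phi psi : (forall w, phi w = psi w) -> mean n phi = mean n psi.
Proof. by move=> h; congr mean; apply: funext. Qed.

Lemma mean_ge0 n phi : (forall w, 0 <= phi w) -> 0 <= mean n phi.
Proof.
by move=> h; apply: sumr_ge0 => a _; rewrite mulr_ge0 ?(ltW (r0 a)) ?expect_ge0.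
Qed.

Lemma mean_cst n c : mean n (fun=> c) = c.
Proof.
rewrite /mean -[RHS]mul1r -[in RHS]r1 mulr_suml.
by apply: eq_bigr => a _; rewrite expect_cst.
Qed.

Lemma meanD n phi psi : mean n (fun w => phi w + psi w) = mean n phi + mean n psi.
Proof. by rewrite -big_split; apply: eq_bigr => a _; rewrite expectD mulrDr. Qed.

Lemma meanZ n c phi : mean n (fun w => c * phi w) = c * mean n phi.
Proof.
by rewrite [RHS]mulr_sumr; apply: eq_bigr => a _; rewrite expectZ mulrCA.
Qed.

Lemma mean_sum n (I : finType) (phi : I -> word d -> R) :
  mean n (fun w => \sum_i phi i w) = \sum_i mean n (phi i).
Proof.
by rewrite exchange_big; apply: eq_bigr => a _; rewrite expect_sum mulr_sumr.
Qed.

Lemma mean_rs_iterD m n phi :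
  mean (m + n) phi = mean m (fun u => E (rs_iter th n u) phi).
Proof. by apply: eq_bigr => a _; rewrite rs_iterD expect_bind. Qed.

Variable lambda : R.
Hypothesis PFr : subst_mx th *m r = lambda *: r.
Hypothesis lambda1 : 1 < lambda.

Lemma lambda_gt0 : 0 < lambda. Proof. exact: lt_trans lambda1. Qed.

Lemma mean_step psi :
  \sum_a r a ord0 * E (th a) (letter_sum psi) = lambda * \sum_a r a ord0 * psi a.
Proof.
have thE a : E (th a) (letter_sum psi) = \sum_b psi b * subst_mx th b a.
  rewrite (_ : letter_sum psi = fun w => \sum_b psi b * (occ [:: b] w)%:R).
    by rewrite expect_sum; apply: eq_bigr => b _; rewrite expectZ mxE.
  apply: funext => w; under eq_bigr do rewrite occ1 mulr_sumr.
  rewrite exchange_big; apply: eq_bigr => a' _.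
  rewrite (bigD1 a') //= eqxx mulr1 big1 ?addr0 // => b /negPf.
  by rewrite eq_sym => ->; rewrite mulr0.
under eq_bigr do rewrite thE mulr_sumr.
rewrite exchange_big mulr_sumr; apply: eq_bigr => b _.
have /matrixP/(_ b ord0) := PFr; rewrite !mxE mulrA => <-.
by rewrite mulr_suml; apply: eq_bigr => a _; ring.
Qed.

Lemma mean_letter_sum n psi :
  mean n (letter_sum psi) = lambda ^+ n * \sum_a r a ord0 * psi a.
Proof.
elim: n psi => [|n IH] psi.
  rewrite expr0 mul1r; apply: eq_bigr => a _.
  by rewrite expect_ret /letter_sum big_seq1.
rewrite -addn1 mean_rs_iterD.
under eq_mean do rewrite expect_letter_sum.
rewrite IH exprD expr1 -mulrA -mean_step; congr (_ * _).
by apply: eq_bigr => a _; rewrite /rs_iter /= bind_retl rs_apply1.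
Qed.

Lemma mean_size n : mean n (fun w => (size w)%:R) = lambda ^+ n.
Proof.
transitivity (mean n (letter_sum (fun=> 1))).
  by apply: eq_mean => w; rewrite /letter_sum big_const_seq count_predT iter_addr_0.
by rewrite mean_letter_sum; under eq_bigr do rewrite mulr1; rewrite r1 mulr1.
Qed.

(** Occurrences inside the images of single letters are occurrences in the image
    of the whole word. *)
Lemma expect_occ_ge n v u :
  letter_sum (fun b => E (rs_iter th n [:: b]) (fun w => (occ v w)%:R)) u <=
  E (rs_iter th n u) (fun w => (occ v w)%:R).
Proof.
elim: u => [|a u IH].
  by rewrite rs_iter_nil expect_ret occ_nil /letter_sum big_nil.
rewrite letter_sum_cons (rs_iter_cons _ _ _ u) expect_cat_law.
apply: (@le_trans _ _ (E (rs_iter th n [:: a]) (fun x => E (rs_iter th n u)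
   (fun y => (occ v x)%:R + (occ v y)%:R)))); last first.
  by apply: le_expect => x _; apply: le_expect => y _; rewrite -natrD ler_nat occ_cat.
under [leRHS]eq_expect => x _ do rewrite expectD expect_cst.
by rewrite [leRHS]expectD expect_cst lerD2l.
Qed.

Lemma mean_occ_step n v :
  lambda * mean n (fun w => (occ v w)%:R) <= mean n.+1 (fun w => (occ v w)%:R).
Proof.
rewrite -[n.+1]add1n mean_rs_iterD -[X in X * _]expr1 -mean_letter_sum.
by apply: le_mean => a w _; apply: expect_occ_ge.
Qed.

End Mean.

Section Frequency.
Variables (R : realType) (d : nat) (th : random_subst R d) (r : 'cV[R]_d.+1).
Variables (lambda : R) (f : word d -> R).
Implicit Types (u v w : word d).
Local Notation E := fdist_expect.
Hypothesis r0 : forall a, 0 < r a ord0.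
Hypothesis r1 : \sum_a r a ord0 = 1.
Hypothesis PFr : subst_mx th *m r = lambda *: r.
Hypothesis lambda1 : 1 < lambda.
Hypothesis f_lim : forall v,
  mean th r n (fun w => (occ v w)%:R) / lambda ^+ n @[n --> \oo] --> f v.

Let l0 : 0 < lambda := lambda_gt0 lambda1.

(** The scaled occurrence counts increase to [f]: the limit bounds every level. *)
Lemma mean_occ_le n v : mean th r n (fun w => (occ v w)%:R) <= lambda ^+ n * f v.
Proof.
rewrite mulrC -ler_pdivrMr ?exprn_gt0 //.
pose s m := mean th r m (fun w => (occ v w)%:R) / lambda ^+ m.
have s_nd : {homo s : m p / (m <= p)%N >-> m <= p}.
  apply: (homo_leq (@lexx _ _) (@le_trans _ _)) => m.
  rewrite /s exprS invfM mulrA ler_pM2r ?invr_gt0 ?exprn_gt0 //.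
  by rewrite ler_pdivlMr // mulrC; apply: mean_occ_step.
have s_lim : s @ \oo --> f v := @f_lim v.
rewrite -(cvg_lim (@Rhausdorff R) s_lim); apply: nondecreasing_cvgn_le => //.
by apply/cvg_ex; exists (f v).
Qed.

Lemma freq_ge0 v : 0 <= f v.
Proof.
have := mean_occ_le 0 v; rewrite expr0 mul1r; apply: le_trans.
by apply: mean_ge0 => // w; rewrite ler0n.
Qed.

Lemma freq_nil : f [::] = 1.
Proof.
have e : (fun n => mean th r n (fun w => (occ [::] w)%:R) / lambda ^+ n) = fun=> 1.
  apply: funext => n; rewrite -(mean_size r1 PFr n).
  rewrite (eq_mean th r n (psi := fun w => (size w)%:R)).
    by rewrite divff // (mean_size r1 PFr) expf_neq0 ?gt_eqF.
  by move=> w; rewrite occ0.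
have := @f_lim [::]; rewrite e => h.
by apply: (cvg_unique _ h (cvg_cst _)); exact: Rhausdorff.
Qed.

Lemma cvg_invX : (lambda ^+ n)^-1 @[n --> \oo] --> (0 : R).
Proof.
under eq_fun do rewrite -exprVn.
by apply: cvg_expr; rewrite ger0_norm ?invr_ge0 ?ltW // invf_lt1.
Qed.

Lemma occ_cons_sum v u : exists2 e : R, 0 <= e <= 1 &
  (occ v u)%:R = e + \sum_(b < d.+1) (occ (b :: v) u)%:R.
Proof.
case: (eqVneq v [::]) => [->|v0].
  by exists 0; rewrite ?lexx ?ler01 // add0r occ0 occ_extend_left0 natr_sum.
exists (prefix v u)%:R; first by rewrite ler0n lern1 leq_b1.
by rewrite occ_extend_left // natrD natr_sum.
Qed.

(** In a long word almost every occurrence of [v] is preceded by a letter. *)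
Lemma freq_cons v : \sum_(b < d.+1) f (b :: v) = f v.
Proof.
pose s n w := mean th r n (fun u => (occ w u)%:R).
have lim_sum : \sum_(b < d.+1) s n (b :: v) / lambda ^+ n @[n --> \oo] -->
    \sum_(b < d.+1) f (b :: v).
  by apply: cvg_big => [|b _]; [exact: add_continuous|exact: f_lim].
have bnd n : \sum_(b < d.+1) s n (b :: v) <= s n v <= \sum_(b < d.+1) s n (b :: v) + 1.
  rewrite -mean_sum; apply/andP; split.
    apply: le_mean => // a w _; have [e e01 ->] := occ_cons_sum v w.
    by rewrite lerDr; case/andP: e01.
  rewrite -[X in _ <= _ + X](mean_cst th r1 n) -meanD.
  apply: le_mean => // a w _; have [e e01 ->] := occ_cons_sum v w.
  by rewrite addrC lerD2l; case/andP: e01.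
apply/eqP; rewrite eq_le; apply/andP; split.
  apply: (ler_cvg_to lim_sum (@f_lim v)); apply: nearW => n.
  rewrite -mulr_suml ler_pM2r ?invr_gt0 ?exprn_gt0 //.
  by case/andP: (bnd n).
have le n : s n v / lambda ^+ n <=
    \sum_(b < d.+1) s n (b :: v) / lambda ^+ n + (lambda ^+ n)^-1.
  rewrite -mulr_suml -[X in _ <= _ + X]mul1r -mulrDl.
  by rewrite ler_pM2r ?invr_gt0 ?exprn_gt0 //; case/andP: (bnd n).
rewrite -[leRHS]addr0.
by apply: (ler_cvg_to (@f_lim v) (cvgD lim_sum cvg_invX)); apply: nearW.
Qed.

Lemma freq_sum n : word_sum n f = 1.
Proof.
elim: n => [|n IH]; first exact: freq_nil.
by rewrite word_sumSr -{}IH; apply: eq_word_sum => w _; apply: freq_cons.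
Qed.

Lemma freq_le_behead b v : f (b :: v) <= f v.
Proof.
rewrite -(freq_cons v) (bigD1 b) //= lerDl.
by apply: sumr_ge0 => c _; apply: freq_ge0.
Qed.

Lemma freq_gt0 n a x v y : x ++ v ++ y \in rs_supp th n [:: a] -> 0 < f v.
Proof.
case: (eqVneq v [::]) => [-> _|v0 wa]; first by rewrite freq_nil.
rewrite -(pmulr_rgt0 _ (exprn_gt0 n l0)).
apply: lt_le_trans (mean_occ_le n v); rewrite /mean (bigD1 a) //=.
apply: ltr_pwDl; last first.
  apply: sumr_ge0 => c _; rewrite mulr_ge0 ?(ltW (r0 c)) //.
  by apply: expect_ge0 => w _; rewrite ler0n.
rewrite mulr_gt0 // lt_neqAle expect_ge0 ?andbT; last by move=> w _; rewrite ler0n.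
apply/negP => /eqP /esym /expect_eq0 h; have := h (fun w _ => ler0n _ _) _ wa.
by move=> /eqP; rewrite pnatr_eq0 -leqn0 leqNgt occ_gt0.
Qed.

End Frequency.

(** * Block entropies are bounded below by inflation word entropies *)

Lemma size_bound (T : eqType) (s : seq (seq T)) :
  exists B, forall w, w \in s -> (size w < B)%N.
Proof.
elim: s => [|u s [B sB]]; first by exists 0%N.
exists (maxn (size u).+1 B) => w; rewrite inE leq_max => /predU1P[->|/sB ->].
  by rewrite leqnn.
by rewrite orbT.
Qed.

Lemma sum_geometric_le (R : realType) (x : R) B : 0 <= x -> x < 1 ->
  \sum_(j < B) x ^+ j <= (1 - x)^-1.
Proof.
move=> x0 x1; rewrite -[leRHS]mul1r ler_pdivlMr ?subr_gt0 // mulrC.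
have := subrX1 x B; have : 0 <= x ^+ B by exact: exprn_ge0.
by set s := \sum_(_ < _) _; lra.
Qed.

Section LowerBound.
Variables (R : realType) (d : nat) (th : random_subst R d) (r : 'cV[R]_d.+1).
Variables (lambda : R) (f : word d -> R).
Implicit Types (u v w : word d).
Local Notation E := fdist_expect.
Hypothesis r0 : forall a, 0 < r a ord0.
Hypothesis r1 : \sum_a r a ord0 = 1.
Hypothesis PFr : subst_mx th *m r = lambda *: r.
Hypothesis lambda1 : 1 < lambda.
Hypothesis f_lim : forall v,
  mean th r n (fun w => (occ v w)%:R) / lambda ^+ n @[n --> \oo] --> f v.

Let f_ge0 := freq_ge0 r0 PFr lambda1 f_lim.
Let f_cons := freq_cons r0 r1 lambda1 f_lim.
Let f_le := freq_le_behead r0 r1 PFr lambda1 f_lim.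

Definition block_entropy n := word_sum n (fun v => - (f v * ln (f v))).

Definition mean_entropy n := \sum_a r a ord0 * fdist_entropy (rs_iter th n [:: a]).

(** The cost of the first letter of [v] given the rest, when words are coded
    from right to left by the Markov chain approximating [f]. *)
Definition letter_cost v := - ln (f v / f (behead v)).

(** The probability that the Markov chain of order [n] with frequencies [f]
    gives to the word [w], read from right to left, once its last [n] letters
    are known. *)
Fixpoint chain_weight n w : R :=
  if w is b :: w' then
    (if (n <= size w')%N then f (b :: take n w') / f (take n w') else 1) *
    chain_weight n w'
  else 1.

Lemma chain_weight_ge0 n w : 0 <= chain_weight n w.
Proof.
elim: w => [|b w IH] /=; first exact: ler01.
by rewrite mulr_ge0 //; case: ifP => _; rewrite ?ler01 ?divr_ge0.
Qed.

Lemma ln_chain_weight n w : (forall x v y, w = x ++ v ++ y -> 0 < f v) ->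
  0 < chain_weight n w /\ - ln (chain_weight n w) = window_sum n.+1 letter_cost w.
Proof.
elim: w => [|b w IH] fw; first by rewrite /= ln1 oppr0.
have [x v y e|w0 lnw] := IH; first by apply: (fw (b :: x) v y); rewrite e.
rewrite [chain_weight _ _]/= [window_sum _ _ _]/= ltnS; case: ifP => nw; last first.
  by rewrite mul1r add0r.
have fbw : 0 < f (b :: take n w).
  by apply: (fw [::] _ (drop n w)); rewrite cat0s cat_cons cat_take_drop.
have fw' : 0 < f (take n w).
  by apply: (fw [:: b] _ (drop n w)); rewrite cat1s cat_take_drop.
split; first by rewrite mulr_gt0 ?divr_gt0.
by rewrite lnM ?posrE ?divr_gt0 // opprD lnw.
Qed.

(** Summing over the leftmost letter multiplies the mass by at most one, except
    for the last [n] letters, which cost a factor [d.+1] each. *)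
Lemma word_sum_chain_weight n j :
  word_sum j (chain_weight n) <= d.+1%:R ^+ minn j n.
Proof.
elim: j => [|j IH]; first by rewrite min0n.
rewrite word_sumSr.
have -> : word_sum j (fun w => \sum_(b < d.+1) chain_weight n (b :: w)) =
   word_sum j (fun w => (\sum_(b < d.+1)
     (if (n <= j)%N then f (b :: take n w) / f (take n w) else 1)) * chain_weight n w).
  by apply: eq_word_sum => w <-; rewrite mulr_suml.
case: leqP => nj; last first.
  rewrite word_sumZ sumr_const card_ord (minn_idPl nj).
  move: IH; rewrite (minn_idPl (ltnW nj)) exprS => IH.
  by rewrite ler_pM2l ?ltr0n.
rewrite (minn_idPr _) ?(leqW nj) //; move: IH; rewrite (minn_idPr nj); apply: le_trans.
apply: le_word_sum => w _; rewrite ler_piMl ?chain_weight_ge0 //.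
rewrite -mulr_suml f_cons; have [->|f0] := eqVneq (f (take n w)) 0; first by rewrite mul0r.
by rewrite divff.
Qed.

Lemma letter_cost_ge0 v : v != [::] -> 0 <= letter_cost v.
Proof.
case: v => // b v _; rewrite oppr_ge0 /= ln_le0 //.
have [->|f0] := eqVneq (f v) 0; first by rewrite invr0 mulr0.
by rewrite ler_pdivrMr ?mul1r // lt_neqAle eq_sym f0 f_ge0.
Qed.

(** The chain rule: the mean cost of a letter is the conditional entropy of a
    letter given the [n] that follow it. *)
Lemma word_sum_letter_cost n :
  word_sum n.+1 (fun v => f v * letter_cost v) = block_entropy n.+1 - block_entropy n.
Proof.
rewrite /block_entropy !word_sumSr -word_sumB; apply: eq_word_sum => w _.
rewrite opprK -[X in _ + X * _]f_cons mulr_suml -big_split; apply: eq_bigr => b _ /=.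
rewrite /letter_cost /=; have [->|fb0] := eqVneq (f (b :: w)) 0.
  by rewrite !mul0r oppr0 addr0.
have fbw : 0 < f (b :: w) by rewrite lt_neqAle eq_sym fb0 f_ge0.
rewrite ln_div ?posrE //; first by ring.
exact: lt_le_trans fbw (f_le _ _).
Qed.

(** Gibbs inequality for the level-[N] inflation words against the Markov measure of
    order [n], damped by [expR (- eps * size)] to have finite total mass. *)
Lemma mean_entropy_le_chain n (eps : R) : 0 < eps -> exists C, forall N,
  mean_entropy N <= lambda ^+ N * (eps + (block_entropy n.+1 - block_entropy n)) + C.
Proof.
move=> eps0; set x := expR (- eps).
have x1 : x < 1 by rewrite expR_lt1 oppr_lt0.
(* At most [d.+1 ^ n] for each length, weighted by the powers of [x]. *)
exists (d.+1%:R ^+ n / (1 - x)) => N.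
set C := _ / _.
pose cost w := eps * (size w)%:R + window_sum n.+1 letter_cost w.
apply: (@le_trans _ _ (mean th r N cost + C)); last first.
  rewrite lerD2r meanD meanZ (mean_size r1 PFr) mulrDr [eps * _]mulrC lerD2l.
  under eq_mean do rewrite window_sum_occ //.
  rewrite mean_sum -word_sum_letter_cost word_sumE mulr_sumr; apply: ler_sum => v _.
  under eq_mean do rewrite mulrC.
  rewrite meanZ mulrC mulrA ler_wpM2r ?letter_cost_ge0 //; first by case: v => -[].
  exact: mean_occ_le.
rewrite -[X in _ + X](mean_cst th r1 N) -meanD; apply: ler_sum => a _.
rewrite ler_pM2l // expectD expect_cst.
pose q w := x ^+ size w * chain_weight n w.
have supp_q w : w \in rs_supp th N [:: a] -> 0 < q w /\ - ln (q w) = cost w.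
  move=> wa; have [y v z e|w0 lnw] := @ln_chain_weight n w.
    apply: (freq_gt0 r0 r1 PFr lambda1 f_lim (n := N) (a := a) (x := y) (y := z)).
    by rewrite -e.
  split; first by rewrite mulr_gt0 // exprn_gt0 // expR_gt0.
  rewrite lnM ?posrE ?exprn_gt0 ?expR_gt0 // opprD lnw; congr (_ + _).
  by rewrite lnXn ?expR_gt0 // expRK mulNrn opprK mulr_natr.
have := @gibbs _ _ (rs_iter th N [:: a]) q (fun w wa => (supp_q w wa).1).
rewrite (eq_expect (h := cost)); last by move=> w /supp_q[].
move=> /le_trans; apply; rewrite -addrA lerD2l.
apply: (@le_trans _ _ (\sum_(w <- rs_supp th N [:: a]) q w)); first by rewrite gerBl ler01.
have [B sB] := size_bound (rs_supp th N [:: a]).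
have q0 w : 0 <= q w by rewrite mulr_ge0 ?chain_weight_ge0 ?exprn_ge0 ?expR_ge0.
apply: le_trans (le_sum_word_sum (fset_uniq _) sB q0) _.
apply: (@le_trans _ _ (\sum_(j < B) d.+1%:R ^+ n * x ^+ j)); last first.
  by rewrite -mulr_sumr ler_pM2l ?exprn_gt0 // sum_geometric_le ?expR_ge0.
apply: ler_sum => j _.
rewrite (eq_word_sum (G := fun w => x ^+ j * chain_weight n w)); last by move=> w <-.
rewrite word_sumZ mulrC ler_pM2r ?exprn_gt0 ?expR_gt0 //.
apply: le_trans (word_sum_chain_weight n j) _.
by rewrite ler_weXn2l ?ler1n ?geq_minr.
Qed.

End LowerBound.

(** * Block entropies are bounded above by inflation word entropies *)

Section Renewal.
Variables (R : realType) (d : nat) (q : word d -> R).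
Implicit Types (u v w : word d).
Hypothesis q0 : forall w, 0 <= q w.
Hypothesis q1 : forall B, \sum_(i < B) word_sum i.+1 q <= 1.

Fixpoint renewal_fuel m u : R :=
  if m is m'.+1 then
    (u == [::])%:R +
      \sum_(i < size u) q (take i.+1 u) * renewal_fuel m' (drop i.+1 u)
  else (u == [::])%:R.

(** The total weight of the factorisations of [u] into non-empty blocks, each
    block weighted by [q]: the probability that a concatenation of independent
    blocks of law [q] has [u] as a prefix ending at the end of a block. *)
Definition renewal u := renewal_fuel (size u) u.

Lemma renewal_fuel_ge0 m u : 0 <= renewal_fuel m u.
Proof.
elim: m u => [|m IH] u /=; first by rewrite ler0n.
by rewrite addr_ge0 ?ler0n // sumr_ge0 // => i _; rewrite mulr_ge0.
Qed.

Lemma renewal_fuelS m u : (size u <= m)%N -> renewal_fuel m.+1 u = renewal_fuel m u.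
Proof.
elim: m u => [|m IH] u; first by case: u => //= _; rewrite big_ord0 addr0.
move=> um; rewrite [LHS]/= [RHS]/=; congr (_ + _); apply: eq_bigr => i _.
congr (_ * _); apply: IH; rewrite size_drop leq_subLR.
by rewrite (leq_trans um) // addSn ltnS leq_addl.
Qed.

Lemma renewal_fuelE m u : (size u <= m)%N -> renewal_fuel m u = renewal u.
Proof.
move=> /subnK <-; elim: (m - size u)%N => [//|j IH].
by rewrite addSn renewal_fuelS // leq_addl.
Qed.

Lemma renewal_nil : renewal [::] = 1. Proof. by []. Qed.

Lemma renewal_cat w u : w != [::] -> q w * renewal u <= renewal (w ++ u).
Proof.
case: w => // b w _; rewrite /(renewal (_ ++ _)).
have sw : (size w < size ((b :: w) ++ u))%N by rewrite size_cat /= leq_addr.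
have -> : size ((b :: w) ++ u) = (size w + size u).+1 by rewrite size_cat.
rewrite [leRHS]/= add0r (bigD1 (Ordinal sw)) //=.
rewrite take_size_cat // drop_size_cat // renewal_fuelE ?leq_addl // lerDl.
by apply: sumr_ge0 => i _; rewrite mulr_ge0 ?renewal_fuel_ge0.
Qed.

Lemma word_sum_renewal_fuel m n : word_sum n (renewal_fuel m) <= 1.
Proof.
elim: m n => [|m IH] [|n]; rewrite ?[word_sum 0 _]/= ?big_ord0 ?addr0 //.
  rewrite (eq_word_sum (G := fun=> 0 * 0)); first by rewrite word_sumZ mul0r ler01.
  by case=> // b w _; rewrite mul0r.
pose F i u := q (take i.+1 u) * renewal_fuel m (drop i.+1 u).
rewrite (eq_word_sum (G := fun u => \sum_(i < n.+1) F i u)); last first.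
  by case=> // b u /= [<-]; rewrite add0r.
rewrite word_sum_sum; apply: le_trans (q1 n.+1); apply: ler_sum => i _.
have nE : n.+1 = (i.+1 + (n - i))%N by rewrite addSn subnKC // -ltnS.
rewrite [X in word_sum X _]nE word_sum_cat; apply: le_word_sum => w sw.
rewrite (eq_word_sum (G := fun v => q w * renewal_fuel m v)) => [|v _].
  by rewrite word_sumZ ler_piMr.
by rewrite /F take_size_cat ?drop_size_cat.
Qed.

(** The mass of the words of length [n] is the probability that a block ends at
    time [n]. *)
Lemma word_sum_renewal n : word_sum n renewal <= 1.
Proof.
by rewrite -(eq_word_sum (F := renewal_fuel n)) ?word_sum_renewal_fuel // => w <-.
Qed.

End Renewal.

(** Spreading the costs of the blocks over the letters and summing over sliding
    windows of length [n] counts every cost at most [n] times. *)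
Section SlidingSum.
Variables (R : realType).
Implicit Types (om : seq R).

Fixpoint sliding_sum n om : R :=
  if om is x :: om' then \sum_(y <- take n om) y + sliding_sum n om' else 0.

Lemma sliding_sumS n om :
  sliding_sum n.+1 om = \sum_(y <- om) y + sliding_sum n (behead om).
Proof.
elim: om => [|x om IH] /=; first by rewrite big_nil addr0.
rewrite IH !big_cons -!addrA; congr (_ + _); rewrite addrCA; congr (_ + _).
by case: om {IH} => [|y om]; rewrite //= big_nil addr0.
Qed.

Lemma sum_seq_ge0 om : (forall x, x \in om -> 0 <= x) -> 0 <= \sum_(y <- om) y.
Proof. by move=> h; rewrite big_seq; apply: sumr_ge0. Qed.

Lemma sliding_sum_le n om : (forall x, x \in om -> 0 <= x) ->
  sliding_sum n om <= n%:R * \sum_(y <- om) y.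
Proof.
elim: n om => [|n IH] om om0.
  rewrite mul0r; elim: om {om0} => //= x om; rewrite big_nil add0r; exact.
rewrite sliding_sumS -natr1 mulrDl mul1r addrC lerD2r.
have b0 x : x \in behead om -> 0 <= x by move=> /mem_behead; apply: om0.
apply: le_trans (IH _ b0) _; rewrite ler_wpM2l //.
by case: om om0 {b0} => // x om om0; rewrite big_cons /= lerDr om0 ?mem_head.
Qed.

End SlidingSum.

Section UpperBound.
Variables (R : realType) (d : nat) (th : random_subst R d) (k : nat).
Implicit Types (u v w : word d) (s : seq ('I_d.+1 * word d)).
Local Notation E := fdist_expect.

(** A block is, with equal weights, a single letter or the level-[k] image of a
    letter, that letter being uniform in both cases. The images code long words
    efficiently, and the single letters code the ends of a window. *)
Definition block_law w : R := (2 * d.+1%:R)^-1 *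
  \sum_a (fdist_ret R [:: a] w + rs_iter th k [:: a] w).

Let c : R := ln (2 * d.+1%:R).

Let D_gt0 : 0 < 2 * d.+1%:R :> R. Proof. by rewrite mulr_gt0 ?ltr0n. Qed.

Let c_ge0 : 0 <= c.
Proof. by rewrite ln_ge0 // -natrM ler1n. Qed.

Lemma block_law_ge0 w : 0 <= block_law w.
Proof.
rewrite mulr_ge0 ?invr_ge0 ?(ltW D_gt0) // sumr_ge0 // => a _.
by rewrite addr_ge0 ?fdist_ge0.
Qed.

Lemma sum_word_sumS_le1 (p : fdist R (word d)) B : \sum_(i < B) word_sum i.+1 p <= 1.
Proof.
apply: le_trans (fdist_word_sum_le1 p B.+1); rewrite [leRHS]big_ord_recl lerDr.
exact: fdist_ge0.
Qed.

Lemma block_law_le1 B : \sum_(i < B) word_sum i.+1 block_law <= 1.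
Proof.
under eq_bigr => i _ do rewrite word_sumZ word_sum_sum.
rewrite -mulr_sumr mulrC ler_pdivrMr // mul1r exchange_big.
rewrite mulr_natr -[X in _ <= _ *+ X]card_ord -sumr_const.
apply: ler_sum => a _; under eq_bigr do rewrite word_sumD.
by rewrite big_split [leRHS](natrD R 1 1) lerD ?sum_word_sumS_le1.
Qed.

Definition window_cost u : R := - ln (renewal block_law u).

Definition block_cost a w : R := c - ln (rs_iter th k [:: a] w).

Lemma block_law_ge_letter a : (2 * d.+1%:R)^-1 <= block_law [:: a].
Proof.
rewrite ler_peMr ?invr_ge0 ?(ltW D_gt0) // (bigD1 a) //= ret_funE eqxx -addrA lerDl.
by rewrite addr_ge0 ?fdist_ge0 // sumr_ge0 // => b _; rewrite addr_ge0 ?fdist_ge0 ?ret_ge0.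
Qed.

Lemma block_law_ge_image a w :
  (2 * d.+1%:R)^-1 * rs_iter th k [:: a] w <= block_law w.
Proof.
rewrite ler_wpM2l ?invr_ge0 ?(ltW D_gt0) // (bigD1 a) //= addrAC lerDr.
by rewrite addr_ge0 ?ret_ge0 // sumr_ge0 // => b _; rewrite addr_ge0 ?fdist_ge0 ?ret_ge0.
Qed.

Let renewal_step := renewal_cat block_law_ge0.

Lemma renewal_gt0 u : 0 < renewal block_law u.
Proof.
elim: u => [|a u IH]; first by rewrite renewal_nil.
apply: lt_le_trans (renewal_step (w := [:: a]) u isT).
by rewrite mulr_gt0 // (lt_le_trans _ (block_law_ge_letter a)) ?invr_gt0.
Qed.

Lemma window_cost_le p w u : w != [::] -> 0 < p -> p <= block_law w ->
  window_cost (w ++ u) <= - ln p + window_cost u.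
Proof.
move=> w0 p0 pw; rewrite -opprD lerN2 -lnM ?posrE ?renewal_gt0 //.
rewrite ler_ln ?posrE ?mulr_gt0 ?renewal_gt0 //.
by apply: le_trans (renewal_step u w0); rewrite ler_pM2r ?renewal_gt0.
Qed.

Lemma window_cost_letters x u : window_cost (x ++ u) <= c * (size x)%:R + window_cost u.
Proof.
elim: x => [|a x IH]; first by rewrite mulr0 add0r.
have p0 : 0 < (2 * d.+1%:R)^-1 :> R by rewrite invr_gt0.
rewrite -cat1s -catA.
apply: le_trans (window_cost_le (w := [:: a]) _ isT p0 (block_law_ge_letter a)) _.
rewrite lnV ?posrE // opprK -[X in c * X]natr1 mulrDr mulr1.
by rewrite -[ln _]/c addrAC [leRHS]addrC lerD2l.
Qed.

Lemma window_cost_le_size u : window_cost u <= c * (size u)%:R.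
Proof.
by have := window_cost_letters u [::]; rewrite cats0 /window_cost renewal_nil ln1 oppr0 addr0.
Qed.

Lemma window_cost_image a w u : w \in rs_supp th k [:: a] ->
  window_cost (w ++ u) <= block_cost a w + window_cost u.
Proof.
move=> wa; apply: le_trans (window_cost_le _ _ _ (block_law_ge_image a w)) _.
- by apply: contraTneq wa => ->; apply: rs_iter_nonnil.
- by rewrite mulr_gt0 ?invr_gt0 // fdist_gt0.
- by rewrite lnM ?posrE ?invr_gt0 ?fdist_gt0 // lnV ?posrE // opprD opprK.
Qed.

Lemma block_cost_ge0 a w : 0 <= block_cost a w.
Proof. by rewrite addr_ge0 // oppr_ge0 ln_le0 // fdist_le1. Qed.

(** The joint law of the images of the letters of a word. The cost of a window is
    read off from these blocks, and [expect_glue] forgets them again. *)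
Fixpoint pieces V : fdist R (seq ('I_d.+1 * word d)) :=
  if V is a :: V' then
    fdist_bind (rs_iter th k [:: a])
      (fun w => fdist_bind (pieces V') (fun s => fdist_ret R ((a, w) :: s)))
  else fdist_ret R [::].

Definition glue s : word d := flatten (map snd s).

Lemma expect_pieces_cons a V g : E (pieces (a :: V)) g =
  E (rs_iter th k [:: a]) (fun w => E (pieces V) (fun s => g ((a, w) :: s))).
Proof.
rewrite expect_bind; apply: eq_expect => w _; rewrite expect_bind.
by apply: eq_expect => s _; rewrite expect_ret.
Qed.

Lemma expect_glue V g : E (pieces V) (fun s => g (glue s)) = E (rs_iter th k V) g.
Proof.
elim: V g => [|a V IH] g; first by rewrite rs_iter_nil !expect_ret.
rewrite rs_iter_cons expect_cat_law expect_pieces_cons; apply: eq_expect => w _.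
exact: (IH (fun y => g (w ++ y))).
Qed.

Lemma expect_pieces_sum V (F : 'I_d.+1 * word d -> R) :
  E (pieces V) (fun s => \sum_(p <- s) F p) =
  letter_sum (fun a => E (rs_iter th k [:: a]) (fun w => F (a, w))) V.
Proof.
elim: V => [|a V IH]; first by rewrite expect_ret /letter_sum !big_nil.
rewrite letter_sum_cons -IH expect_pieces_cons.
under eq_expect => w _ do under eq_expect => s _ do rewrite big_cons.
under eq_expect => w _ do rewrite expectD expect_cst.
by rewrite expectD expect_cst.
Qed.

Definition legal_pieces s := forall p, p \in s -> p.2 \in rs_supp th k [:: p.1].

Lemma mem_pieces V s : s \in finsupp (pieces V) -> legal_pieces s.
Proof.
elim: V s => [|a V IH] s; first by rewrite mem_finsupp_ret => /eqP ->.
case/mem_finsupp_bind => w wa /mem_finsupp_bind[s' /IH sl].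
by rewrite mem_finsupp_ret => /eqP -> p; rewrite inE => /predU1P[->|/sl].
Qed.

(** The cost of each block sits on its first letter, so that the letters of a
    window carry the costs of the blocks that start in it. *)
Definition spread s : seq R :=
  flatten [seq block_cost p.1 p.2 :: nseq (size p.2).-1 0 | p <- s].

Lemma spread_ge0 s x : x \in spread s -> 0 <= x.
Proof.
case/flattenP => _ /mapP[p _ ->]; rewrite inE => /predU1P[->|/nseqP[->]] //.
exact: block_cost_ge0.
Qed.

Lemma sum_spread s : \sum_(x <- spread s) x = \sum_(p <- s) block_cost p.1 p.2.
Proof.
elim: s => [|p s IH]; first by rewrite !big_nil.
rewrite /spread /= !big_cons big_cat -!/(spread _) IH /=.
by rewrite big1_seq ?add0r // => x /andP[_ /nseqP[->]].
Qed.

Variable L : nat.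
Hypothesis size_image : forall a w, w \in rs_supp th k [:: a] -> (size w <= L)%N.

(** A window starting at the start of a block is coded block by block; only the
    block cut by its right end, of length at most [L], is coded by letters. *)
Lemma window_cost_prefix s j : legal_pieces s ->
  window_cost (take j (glue s)) <= L%:R * c + \sum_(x <- take j (spread s)) x.
Proof.
have Lc : 0 <= L%:R * c by rewrite mulr_ge0 ?ler0n.
have sum0 i s' : 0 <= \sum_(x <- take i (spread s')) x.
  by apply: sum_seq_ge0 => x /mem_take /spread_ge0.
elim: s j => [|[a w] s IH] j sl.
  by rewrite big_nil addr0 (le_trans (window_cost_le_size _)) // mulr0.
have wa : w \in rs_supp th k [:: a] by apply: (sl (a, w)); rewrite mem_head.
have {}IH i := IH i (fun p ps => sl p (mem_behead (s := _ :: s) ps)).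
have w0 : w != [::] by apply: contraTneq wa => ->; apply: rs_iter_nonnil.
have sw : size (block_cost a w :: nseq (size w).-1 0) = size w.
  by rewrite /= size_nseq prednK // lt0n size_eq0.
rewrite /glue /spread /= -cat_cons -/(glue s) -/(spread s) !take_cat sw.
case: ltnP => jw.
  apply: (@le_trans _ _ (L%:R * c)); last first.
    rewrite lerDl; apply: sum_seq_ge0 => x /mem_take.
    by rewrite inE => /predU1P[->|/nseqP[->]] //; exact: block_cost_ge0.
  rewrite (le_trans (window_cost_le_size _)) // mulrC ler_wpM2r // ler_nat.
  by rewrite size_take jw ltnW // (leq_trans jw) // (size_image wa).
rewrite big_cat big_cons [X in _ + (_ + X + _)]big1_seq; last by move=> x /andP[_ /nseqP[->]].
rewrite addr0 addrCA; apply: le_trans (window_cost_image _ wa) _.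
by rewrite lerD2l.
Qed.

(** The window may also cut a block at its left end, whence the factor 2. *)
Lemma window_cost_factor s i j : legal_pieces s ->
  window_cost (take j (drop i (glue s))) <=
  2 * L%:R * c + \sum_(x <- take j (drop i (spread s))) x.
Proof.
have Lc : 0 <= L%:R * c by rewrite mulr_ge0 ?ler0n.
elim: s i j => [|[a w] s IH] i j sl.
  rewrite big_nil addr0 (le_trans (window_cost_le_size _)) // mulr0.
  by rewrite -mulrA mulr_ge0.
have wa : w \in rs_supp th k [:: a] by apply: (sl (a, w)); rewrite mem_head.
have sl' : legal_pieces s by move=> p ps; apply: sl; rewrite inE ps orbT.
have w0 : w != [::] by apply: contraTneq wa => ->; apply: rs_iter_nonnil.
have sw : size (block_cost a w :: nseq (size w).-1 0) = size w.
  by rewrite /= size_nseq prednK // lt0n size_eq0.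
have spread0 x : x \in block_cost a w :: nseq (size w).-1 0 -> 0 <= x.
  by rewrite inE => /predU1P[->|/nseqP[->]] //; exact: block_cost_ge0.
rewrite /glue /spread /= -cat_cons -/(glue s) -/(spread s) !drop_cat sw.
case: ltnP => iw; last exact: IH.
have szx : (size (drop i w) <= L)%N.
  by rewrite size_drop (leq_trans (leq_subr _ _)) // (size_image wa).
rewrite !take_cat !size_drop sw; case: ltnP => jw.
  rewrite (le_trans (window_cost_le_size _)) //.
  apply: (@le_trans _ _ (2 * L%:R * c)); last first.
    by rewrite lerDl; apply: sum_seq_ge0 => x /mem_take /mem_drop /spread0.
  rewrite -mulrA mulrDl mul1r -[leLHS]addr0 lerD // mulrC ler_wpM2r // ler_nat.
  by rewrite size_take size_drop jw ltnW // (leq_trans jw) // -size_drop.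
apply: le_trans (window_cost_letters _ _) _.
rewrite big_cat /= -[2 * _ * _]mulrA mulrDl mul1r -addrA lerD //.
  by rewrite mulrC ler_wpM2r // ler_nat.
apply: le_trans (window_cost_prefix _ sl') _; rewrite lerD2l lerDr.
by apply: sum_seq_ge0 => x /mem_drop /spread0.
Qed.

Lemma window_sum_sliding n W om (C : R) : size W = size om -> 0 <= C ->
  (forall x, x \in om -> 0 <= x) ->
  (forall i, window_cost (take n (drop i W)) <= C + \sum_(x <- take n (drop i om)) x) ->
  window_sum n window_cost W <= C * (size W)%:R + sliding_sum n om.
Proof.
move=> + C0; elim: W om => [|b W IH] [|x om] //= sz om0 le.
  by rewrite mulr0 addr0.
have IH' : window_sum n window_cost W <= C * (size W)%:R + sliding_sum n om.
  apply: IH; [exact: succn_inj|move=> y yom|move=> i; exact: (le i.+1)].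
  by apply: om0; rewrite inE yom orbT.
have sum0 : 0 <= \sum_(y <- take n (x :: om)) y.
  by apply: sum_seq_ge0 => y /mem_take /om0.
rewrite -natr1 mulrDr mulr1 [C * _ + C]addrC addrACA lerD //.
by case: ifP => _; [exact: (le 0%N)|rewrite addr_ge0].
Qed.

Lemma size_spread s : legal_pieces s -> size (spread s) = size (glue s).
Proof.
elim: s => [//|[a w] s IH] sl.
have wa : w \in rs_supp th k [:: a] by apply: (sl (a, w)); rewrite mem_head.
have sl' : legal_pieces s by move=> p ps; apply: sl; rewrite inE ps orbT.
rewrite /glue /spread /= !size_cat size_nseq -addSn IH // prednK // lt0n size_eq0.
by apply: contraTneq wa => ->; apply: rs_iter_nonnil.
Qed.

Lemma window_sum_glue n s : legal_pieces s ->
  window_sum n window_cost (glue s) <=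
  2 * L%:R * c * (size (glue s))%:R + n%:R * \sum_(p <- s) block_cost p.1 p.2.
Proof.
move=> sl; apply: le_trans
  (window_sum_sliding (C := 2 * L%:R * c) (esym (size_spread sl)) _ _ _) _.
- by rewrite -mulrA mulr_ge0 // mulr_ge0 ?ler0n.
- by move=> x; exact: spread_ge0.
- by move=> i; exact: window_cost_factor.
by rewrite lerD2l -sum_spread sliding_sum_le // => x; exact: spread_ge0.
Qed.

Variables (r : 'cV[R]_d.+1) (lambda : R) (f : word d -> R).
Hypothesis r0 : forall a, 0 < r a ord0.
Hypothesis r1 : \sum_a r a ord0 = 1.
Hypothesis PFr : subst_mx th *m r = lambda *: r.
Hypothesis lambda1 : 1 < lambda.
Hypothesis f_lim : forall v,
  mean th r n (fun w => (occ v w)%:R) / lambda ^+ n @[n --> \oo] --> f v.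

Let l0 : 0 < lambda := lambda_gt0 lambda1.

Lemma mean_window_sum_le n N :
  mean th r (N + k) (window_sum n window_cost) <=
  lambda ^+ (N + k) * (2 * L%:R * c) + lambda ^+ N * (n%:R * (c + mean_entropy th r k)).
Proof.
rewrite mean_rs_iterD.
pose H b := fdist_entropy (rs_iter th k [:: b]).
apply: (@le_trans _ _ (mean th r N (fun u =>
    2 * L%:R * c * E (rs_iter th k u) (fun w => (size w)%:R) +
    n%:R * letter_sum (fun b => c + H b) u))).
  apply: le_mean => // a u _.
  rewrite -(expect_glue u (window_sum _ _)) -(expect_glue u (fun w => (size w)%:R)).
  have -> : letter_sum (fun b => c + H b) u =
      E (pieces u) (fun s => \sum_(p <- s) block_cost p.1 p.2).
    rewrite (expect_pieces_sum u (fun p => block_cost p.1 p.2)).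
    apply: eq_bigr => b _; rewrite /block_cost expectD expect_cst /H.
    by rewrite entropyE.
  rewrite -!expectZ -expectD; apply: le_expect => s /mem_pieces sl.
  exact: window_sum_glue.
rewrite meanD !meanZ -mean_rs_iterD (mean_size r1 PFr) mulrC lerD2l.
rewrite (mean_letter_sum PFr) mulrCA; under eq_bigr do rewrite mulrDr.
by rewrite big_split /= -mulr_suml r1 mul1r.
Qed.

(** Gibbs inequality for [f] on the words of length [n] against the renewal
    measure; the cross-entropy is a limit of window averages in long images. *)
Lemma block_entropy_le_renewal n : (0 < n)%N ->
  block_entropy f n <= n%:R * ((lambda ^+ k)^-1 * (c + mean_entropy th r k)) +
    2 * L%:R * c.
Proof.
move=> n0.
have f0 := freq_ge0 r0 PFr lambda1 f_lim.
apply: (@le_trans _ _ (word_sum n (fun v => f v * window_cost v))).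
  apply: (@le_trans _ _ (word_sum n (fun v =>
      f v * window_cost v + (renewal block_law v - f v)))).
    apply: le_word_sum => v _; rewrite /window_cost mulrN addrA.
    by apply: gibbs_term; rewrite ?renewal_gt0.
  rewrite word_sumD gerDl word_sumB (freq_sum r0 r1 PFr lambda1 f_lim) subr_le0.
  exact: word_sum_renewal block_law_ge0 block_law_le1 _.
(* Shifted by [k]: a level-[k] decomposition exists from level [k] on. *)
pose s N v := mean th r (N + k) (fun w => (occ v w)%:R) / lambda ^+ (N + k).
have s_lim v : s N v * window_cost v @[N --> \oo] --> f v * window_cost v.
  apply: cvgM; last exact: cvg_cst.
  rewrite /s (cvg_shiftn k (fun N => mean th r N (fun w => (occ v w)%:R) / lambda ^+ N)).
  exact: f_lim.
apply: (cvgr_to_le (cvg_word_sum (n := n) s_lim)); apply: nearW => N.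
have -> : word_sum n (fun v => s N v * window_cost v) =
    mean th r (N + k) (window_sum n window_cost) / lambda ^+ (N + k).
  under eq_mean do rewrite window_sum_occ //.
  rewrite mean_sum mulr_suml word_sumE; apply: eq_bigr => v _.
  by under eq_mean do rewrite mulrC; rewrite meanZ /s mulrC mulrA.
rewrite ler_pdivrMr ?exprn_gt0 //; apply: le_trans (mean_window_sum_le n N) _.
rewrite exprD le_eqVlt; apply/orP; left; apply/eqP.
by field; rewrite expf_neq0 ?gt_eqF.
Qed.

End UpperBound.

(** * Unique realisation paths and the growth of inflation word entropies *)

Section UniqueRealisation.
Variables (R : realType) (d : nat) (th : random_subst R d).
Implicit Types (u v w : word d).
Local Notation E := fdist_expect.
Local Notation H := (@fdist_entropy R _).

Lemma entropy_cat_law (p q : fdist R (word d)) :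
  (forall x x' y y', x \in finsupp p -> x' \in finsupp p ->
    y \in finsupp q -> y' \in finsupp q -> x ++ y = x' ++ y' -> x = x') ->
  H (cat_law p q) = H p + H q.
Proof.
move=> inj; pose K x := fdist_bind q (fun y => fdist_ret R (x ++ y)).
have HK x : H (K x) = H q.
  rewrite -[RHS]addr0 -(expect_cst q 0).
  rewrite [X in _ + X](eq_expect (h := fun y => H (fdist_ret R (x ++ y)))).
    apply/entropy_bind_le_eq => y y' _ _ yy'; apply/eqP; rewrite -fsubset0.
    apply/fsubsetP => w; rewrite in_fsetI !mem_finsupp_ret => /andP[/eqP -> /eqP].
    by move=> /(congr1 (drop (size x))); rewrite !drop_size_cat // => /eqP; rewrite (negPf yy').
  by move=> y _; rewrite entropy_ret.
rewrite -(expect_cst p (H q)) (eq_expect (h := fun x => H (K x))) => [|x _]; last by rewrite HK.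
apply/entropy_bind_le_eq => x x' xp xp' xx'; apply/eqP; rewrite -fsubset0.
apply/fsubsetP => w; rewrite in_fsetI => /andP[/mem_finsupp_bind[y yq]].
rewrite mem_finsupp_ret => /eqP -> /mem_finsupp_bind[y' yq'].
by rewrite mem_finsupp_ret => /eqP /(inj _ _ _ _ xp xp' yq yq') /eqP; rewrite (negPf xx').
Qed.

Lemma rs_supp_pieces k u w : w \in rs_supp th k u ->
  exists2 s, all2 (fun a x => x \in rs_supp th k [:: a]) u s & flatten s = w.
Proof.
elim: u w => [|a u IH] w.
  by rewrite /rs_supp rs_iter_nil mem_finsupp_ret => /eqP ->; exists [::].
rewrite /rs_supp rs_iter_cons => /mem_cat_law[x [y [xa /IH[s us <-] ->]]].
by exists (x :: s) => //=; rewrite us andbT.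
Qed.

Lemma language_behead a u : language th (a :: u) -> language th u.
Proof.
case=> b [k [w [k0 wk iw]]]; exists b, k, w; split=> //.
exact: consl_infix iw.
Qed.

Hypothesis urp : unique_realisation_paths th.

(** With unique realisation paths, the images of the letters of a legal word can
    be read off from their concatenation, so that entropy is additive. *)
Lemma entropy_rs_iter k u : (0 < k)%N -> language th u ->
  H (rs_iter th k u) = letter_sum (fun b => H (rs_iter th k [:: b])) u.
Proof.
move=> k0; elim: u => [|a u IH] lu.
  by rewrite rs_iter_nil entropy_ret /letter_sum big_nil.
rewrite letter_sum_cons rs_iter_cons -(IH (language_behead lu)) -entropy_cat_law //.
move=> x x' y y' xa xa' /rs_supp_pieces[s us <-] /rs_supp_pieces[t ut <-] e.
suff [] : x :: s = x' :: t by [].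
by apply: (urp (n := (size u).+1) isT k0 lu) => //; apply/andP.
Qed.

Variables (r : 'cV[R]_d.+1) (lambda : R).
Hypothesis r0 : forall a, 0 < r a ord0.
Hypothesis PFr : subst_mx th *m r = lambda *: r.

(** The conditional entropy of level [k + m] given level [k]; additivity along
    the letters turns it into a letter statistic of level [k]. *)
Lemma mean_conditional_entropy k m : (0 < k)%N -> (0 < m)%N ->
  lambda ^+ k * mean_entropy th r m =
  \sum_a r a ord0 * E (rs_iter th k [:: a]) (fun u => H (rs_iter th m u)).
Proof.
move=> k0 m0; rewrite -(mean_letter_sum PFr); apply: eq_bigr => a _; congr (_ * _).
apply: eq_expect => u ua; rewrite entropy_rs_iter //.
by exists a, k, u; split=> //; apply: infix_refl.
Qed.

Lemma eq_weighted_sum (X Y : 'I_d.+1 -> R) : (forall a, X a <= Y a) ->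
  \sum_a r a ord0 * X a = \sum_a r a ord0 * Y a <-> forall a, X a = Y a.
Proof.
move=> XY; split=> [e a|h]; last by apply: eq_bigr => a _; rewrite h.
have : \sum_a r a ord0 * (Y a - X a) = 0.
  by under eq_bigr do rewrite mulrBr; rewrite sumrB e subrr.
move=> /eqP; rewrite psumr_eq0; last by move=> b _; rewrite mulr_ge0 ?subr_ge0 // ltW.
move=> /allP/(_ a (mem_index_enum _)) /=.
by rewrite mulf_eq0 gt_eqF //= subr_eq0 => /eqP.
Qed.

Lemma mean_entropyD_ge k m : (0 < k)%N -> (0 < m)%N ->
  lambda ^+ k * mean_entropy th r m <= mean_entropy th r (k + m).
Proof.
move=> k0 m0; rewrite mean_conditional_entropy //; apply: ler_sum => a _.
by rewrite ler_pM2l // rs_iterD entropy_bind_ge.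
Qed.

Lemma mean_entropyD_ge_eq k m : (0 < k)%N -> (0 < m)%N ->
  lambda ^+ k * mean_entropy th r m = mean_entropy th r (k + m) <->
  forall a u u', u \in rs_supp th k [:: a] -> u' \in rs_supp th k [:: a] ->
    rs_iter th m u = rs_iter th m u'.
Proof.
move=> k0 m0; rewrite mean_conditional_entropy //.
rewrite eq_weighted_sum; last by move=> a; rewrite rs_iterD entropy_bind_ge.
split=> h a; last by rewrite rs_iterD; apply/entropy_bind_ge_eq => u u'; apply: h.
by have := h a; rewrite rs_iterD => /entropy_bind_ge_eq.
Qed.

Lemma mean_entropyD_le k m : (0 < k)%N -> (0 < m)%N ->
  mean_entropy th r (k + m) <= mean_entropy th r k + lambda ^+ k * mean_entropy th r m.
Proof.
move=> k0 m0; rewrite mean_conditional_entropy // -big_split /=; apply: ler_sum => a _.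
by rewrite -mulrDr ler_pM2l // rs_iterD entropy_bind_le.
Qed.

Lemma mean_entropyD_le_eq k m : (0 < k)%N -> (0 < m)%N ->
  mean_entropy th r (k + m) = mean_entropy th r k + lambda ^+ k * mean_entropy th r m <->
  forall a u u', u \in rs_supp th k [:: a] -> u' \in rs_supp th k [:: a] -> u != u' ->
    (rs_supp th m u `&` rs_supp th m u' = fset0)%fset.
Proof.
move=> k0 m0; rewrite mean_conditional_entropy // -big_split /=.
under [X in _ = X <-> _]eq_bigr do rewrite -mulrDr.
rewrite eq_weighted_sum; last by move=> a; rewrite rs_iterD entropy_bind_le.
split=> h a; last by rewrite rs_iterD; apply/entropy_bind_le_eq => u u'; apply: h.
by have := h a; rewrite rs_iterD => /entropy_bind_le_eq.
Qed.

End UniqueRealisation.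

(** * The entropy as a limit of inflation word entropies *)

Section EntropyLimit.
Variables (R : realType) (d : nat) (th : random_subst R d) (r : 'cV[R]_d.+1).
Variables (lambda : R) (f : word d -> R).
Hypothesis r0 : forall a, 0 < r a ord0.
Hypothesis r1 : \sum_a r a ord0 = 1.
Hypothesis PFr : subst_mx th *m r = lambda *: r.
Hypothesis lambda1 : 1 < lambda.
Hypothesis f_lim : forall v,
  mean th r n (fun w => (occ v w)%:R) / lambda ^+ n @[n --> \oo] --> f v.
Hypothesis urp : unique_realisation_paths th.

Let l0 : 0 < lambda := lambda_gt0 lambda1.

Definition scaled_entropy n := (lambda ^+ n)^-1 * mean_entropy th r n.
Local Notation S := scaled_entropy.

Lemma mean_entropyE n : mean_entropy th r n = lambda ^+ n * S n.
Proof. by rewrite mulVKf // expf_neq0 ?gt_eqF. Qed.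

Lemma mean_entropy_ge0 n : 0 <= mean_entropy th r n.
Proof. by apply: sumr_ge0 => a _; rewrite mulr_ge0 ?(ltW (r0 a)) ?entropy_ge0. Qed.

(** Conditioning level [n.+1] on its first step gives independent level-[n]
    inflation words, [lambda] of them on average. *)
Lemma scaled_entropy_homo m n : (0 < m)%N -> (m <= n)%N -> S m <= S n.
Proof.
move=> m0 /subnK <-; elim: (n - m)%N => [//|j IH]; apply: le_trans IH _.
have := @mean_entropyD_ge _ _ _ urp _ _ r0 PFr 1 (j + m) isT (ltn_addl j m0).
rewrite add1n -addSn !mean_entropyE mulrA -exprS addSn.
by rewrite ler_pM2l ?exprn_gt0.
Qed.

Lemma scaled_entropy_le_increment k n : (0 < k)%N ->
  S k <= block_entropy f n.+1 - block_entropy f n.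
Proof.
move=> k0; apply/ler_addgt0Pl => eps eps0.
have [C hC] := mean_entropy_le_chain r0 r1 PFr lambda1 f_lim n eps0.
set D := eps + _ in hC *.
have lim : D + C * (lambda ^+ N)^-1 @[N --> \oo] --> D + C * 0.
  by apply: cvgD; [exact: cvg_cst|apply: cvgMr; exact: cvg_invX].
rewrite -[D]addr0 -[X in D + X](mulr0 C).
apply: (cvgr_to_ge lim); near=> N.
have kN : (k <= N)%N by near: N; exact: nbhs_infty_ge.
apply: le_trans (scaled_entropy_homo k0 kN) _.
rewrite /S mulrC ler_pdivrMr ?exprn_gt0 // mulrDl divfK ?expf_neq0 ?gt_eqF //.
by rewrite mulrC; apply: hC.
Unshelve. all: by end_near.
Qed.

Lemma scaled_entropy_le_block k n : (0 < k)%N -> n%:R * S k <= block_entropy f n.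
Proof.
move=> k0; elim: n => [|n IH].
  by rewrite mul0r /block_entropy /= (freq_nil r1 PFr lambda1 f_lim) ln1 mulr0 oppr0.
have := scaled_entropy_le_increment n k0.
rewrite -natr1 mulrDl mul1r => h; lra.
Qed.

Definition entropy_limit := limn (fun n => S n.+1).

Lemma is_cvg_scaled_entropy : cvgn (fun n => S n.+1).
Proof.
apply: nondecreasing_is_cvgn => [m n mn|]; first exact: scaled_entropy_homo.
exists (block_entropy f 1) => _ [n _ <-].
by have := @scaled_entropy_le_block n.+1 1 isT; rewrite mul1r.
Qed.

Lemma scaled_entropy_le_limit k : (0 < k)%N -> S k <= entropy_limit.
Proof.
case: k => // k _; apply: (nondecreasing_cvgn_le (u_ := fun n => S n.+1)).
  by move=> m n mn; exact: scaled_entropy_homo.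
exact: is_cvg_scaled_entropy.
Qed.

Lemma entropy_limit_le x : (forall k, (0 < k)%N -> S k <= x) -> entropy_limit <= x.
Proof. by move=> h; apply: limr_le; [exact: is_cvg_scaled_entropy|apply: nearW => n; exact: h]. Qed.

Lemma letter_image_bound k :
  exists L, forall a w, w \in rs_supp th k [:: a] -> (size w <= L)%N.
Proof.
have [L hL] := size_bound (flatten [seq enum_fset (rs_supp th k [:: a]) | a <- enum 'I_d.+1]).
exists L => a w wa; apply/ltnW/hL/flattenP; exists (enum_fset (rs_supp th k [:: a])) => //.
by apply: map_f; rewrite mem_enum.
Qed.

(** The lower bound [S k] and the upper bound [S k + c / lambda ^+ k + O(1 / n)]
    for the block entropy per letter pinch as [n] and then [k] grow. *)
Lemma block_entropy_cvg : n%:R^-1 * block_entropy f n @[n --> \oo] --> entropy_limit.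
Proof.
apply/cvgrPdist_le => eps eps0.
set c : R := ln (2 * d.+1%:R).
have c0 : 0 <= c by rewrite ln_ge0 // -natrM ler1n.
(* The level [k] first, since the bound [L] on block lengths depends on it. *)
have [k k0 ck] : exists2 k, (0 < k)%N & (lambda ^+ k)^-1 * c <= eps / 2.
  have : (lambda ^+ k)^-1 * c @[k --> \oo] --> 0 * c.
    by apply: cvgMl; exact: cvg_invX.
  rewrite mul0r => /cvgrPdist_le /(_ (eps / 2)) []; first by rewrite divr_gt0.
  move=> K _ hK; exists K.+1 => //; have := hK K.+1 (leqnSn K).
  by rewrite /= sub0r normrN; apply: le_trans; exact: ler_norm.
have [L hL] := letter_image_bound k.
near=> n.
have n0 : (0 < n)%N by near: n; exact: nbhs_infty_gt.
have nR : 0 < n%:R :> R by rewrite ltr0n.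
have nL : 2 * L%:R * c / n%:R <= eps / 2.
  rewrite ler_pdivrMr // [leRHS]mulrC -ler_pdivrMr ?divr_gt0 //.
  near: n; exact: nbhs_infty_ger.
have lo : entropy_limit <= n%:R^-1 * block_entropy f n.
  apply: entropy_limit_le => j j0; rewrite mulrC ler_pdivlMr // mulrC.
  exact: scaled_entropy_le_block.
rewrite distrC ger0_norm ?subr_ge0 // lerBlDr.
have up := block_entropy_le_renewal hL r0 r1 PFr lambda1 f_lim n0.
have {up} : n%:R^-1 * block_entropy f n <=
    (lambda ^+ k)^-1 * c + S k + 2 * L%:R * c / n%:R.
  rewrite mulrC ler_pdivrMr // mulrDl divfK ?gt_eqF // /S -mulrDr.
  by rewrite [X in _ <= X + _]mulrC.
have := scaled_entropy_le_limit k0; lra.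
Unshelve. all: by end_near.
Qed.

Section Bounds.
Variable k : nat.
Hypothesis k0 : (0 < k)%N.
Local Notation HR := (mean_entropy th r).

Let mulk0 j : (0 < j.+1 * k)%N. Proof. by rewrite muln_gt0. Qed.

(** Since [S] is non-decreasing, it has reached its limit at [k] exactly when it
    never grows along the multiples of [k]. *)
Lemma lower_bound_eq : S k = entropy_limit <->
  forall j, lambda ^+ k * HR (j.+1 * k) = HR (k + j.+1 * k).
Proof.
have stepE j : lambda ^+ k * HR (j.+1 * k) = HR (k + j.+1 * k) <->
    S (j.+1 * k) = S (j.+2 * k).
  rewrite !mean_entropyE mulrA -exprD -mulSn; split=> [/mulfI -> //|-> //].
  by rewrite expf_neq0 ?gt_eqF.
split=> [e j|h].
  apply/stepE; suff Sk i : S (i.+1 * k) = entropy_limit by rewrite !Sk.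
  apply/eqP; rewrite eq_le scaled_entropy_le_limit //= -e.
  by apply: scaled_entropy_homo => //; rewrite mulSn leq_addr.
have Sj j : S (j.+1 * k) = S k.
  by elim: j => [|j IH]; [rewrite mul1n|rewrite -IH; apply/esym/stepE].
apply/eqP; rewrite eq_le scaled_entropy_le_limit //=.
apply: entropy_limit_le => -[//|m] _; rewrite -(Sj m).
by apply: scaled_entropy_homo => //; rewrite leq_pmulr.
Qed.

(** The upper bound after [j] steps of length [k]: what remains of the geometric
    series bounds the growth of [S] after step [j * k]. It decreases to the
    limit of [S] from [upper 1], which is [HR k / (lambda ^+ k - 1)]. *)
Let upper j := S (j * k) + HR k * (lambda ^+ k) ^- j / (lambda ^+ k - 1).

Let lk1 : 1 < lambda ^+ k. Proof. by rewrite exprn_egt1 // -lt0n. Qed.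

Let upper1 : upper 1 = (lambda ^+ k - 1)^-1 * HR k.
Proof.
rewrite /upper mul1n /S; field.
by rewrite subr_eq0 !gt_eqF // exprn_gt0.
Qed.

Let upperB j : upper j.+1 - upper j =
  (HR (k + j * k) - (HR k + lambda ^+ k * HR (j * k))) * (lambda ^+ k) ^- j.+1.
Proof.
rewrite /upper /S mulSn exprD mulnC exprM exprS; field.
by rewrite subr_eq0 !expf_neq0 ?gt_eqF.
Qed.

Let upper_homo i j : (i <= j)%N -> upper j.+1 <= upper i.+1.
Proof.
move=> /subnK <-; elim: (j - i)%N => [//|m IH]; apply: le_trans IH.
rewrite addSn -subr_le0 upperB; apply: mulr_le0_ge0; last first.
  by rewrite invr_ge0 !exprn_ge0 // ltW.
by rewrite subr_le0; apply: mean_entropyD_le.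
Qed.

Let S_le_upper j : S (j * k) <= upper j.
Proof.
rewrite /upper lerDl mulr_ge0 ?invr_ge0 ?subr_ge0 ?(ltW lk1) //.
by rewrite mulr_ge0 ?mean_entropy_ge0 // invr_ge0 !exprn_ge0 // ltW.
Qed.

Let limit_le_upper j : entropy_limit <= upper j.+1.
Proof.
apply: entropy_limit_le => m m0.
apply: le_trans (upper_homo (leq_maxl j m)); apply: le_trans (S_le_upper _).
apply: scaled_entropy_homo => //.
by rewrite (leq_trans _ (leq_pmulr _ k0)) // leqW // leq_maxr.
Qed.

Lemma entropy_limit_le_upper : entropy_limit <= (lambda ^+ k - 1)^-1 * HR k.
Proof. by rewrite -upper1; apply: limit_le_upper. Qed.

Lemma upper_bound_eq : entropy_limit = (lambda ^+ k - 1)^-1 * HR k <->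
  forall j, HR (k + j.+1 * k) = HR k + lambda ^+ k * HR (j.+1 * k).
Proof.
have stepE j : HR (k + j.+1 * k) = HR k + lambda ^+ k * HR (j.+1 * k) <->
    upper j.+2 = upper j.+1.
  split=> [e|e]; first by apply/eqP; rewrite -subr_eq0 upperB e subrr mul0r.
  apply/eqP; rewrite -subr_eq0; have /eqP := upperB j.+1.
  rewrite e subrr eq_sym mulf_eq0 => /orP[//|].
  by rewrite invr_eq0 expf_eq0 /= gt_eqF // exprn_gt0.
rewrite -upper1; split=> [e j|h].
  apply/stepE; suff uj i : upper i.+1 = entropy_limit by rewrite !uj.
  by apply/eqP; rewrite eq_le limit_le_upper e upper_homo.
have uj j : upper j.+1 = upper 1 by elim: j => // j <-; apply/stepE.
apply/eqP; rewrite eq_le limit_le_upper /=.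
have lim : entropy_limit + HR k / (lambda ^+ k - 1) * (lambda ^+ k ^+ j)^-1
    @[j --> \oo] --> entropy_limit + HR k / (lambda ^+ k - 1) * 0.
  by apply: cvgD; [exact: cvg_cst|apply: cvgMr; exact: cvg_invX].
rewrite -[leRHS]addr0 -[X in _ <= _ + X](mulr0 (HR k / (lambda ^+ k - 1))).
apply: (cvgr_to_ge lim); near=> j.
have j0 : (0 < j)%N by near: j; exact: nbhs_infty_gt.
rewrite -(uj j.-1) prednK // /upper mulrAC lerD2r.
by apply: scaled_entropy_le_limit; rewrite muln_gt0 j0.
Unshelve. all: by end_near.
Qed.

End Bounds.
End EntropyLimit.

(** * The frequency measure *)

Section FrequencyMeasure.
Variables (R : realType) (d : nat) (th : random_subst R d) (r : 'cV[R]_d.+1).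
Variables (lambda : R) (mu : probability (borel_shift d) R).
Implicit Types (u v w : word d).
Local Notation E := fdist_expect.
Hypothesis r0 : forall a, 0 < r a ord0.
Hypothesis r1 : \sum_a r a ord0 = 1.
Hypothesis PFr : subst_mx th *m r = lambda *: r.
Hypothesis lambda1 : 1 < lambda.
Hypothesis mu_freq : frequency_measure th mu.

Let l0 : 0 < lambda := lambda_gt0 lambda1.

Definition freq v := fine (mu (cylinder th v)).

Lemma freq_notin_language v : ~ language th v -> freq v = 0.
Proof.
move=> nv; rewrite /freq (_ : cylinder th v = classical_sets.set0) ?measure0 //.
rewrite -subset0 => x [xth xv]; apply: nv; rewrite -xv; exact: xth.
Qed.

Lemma occ_infix v u : (0 < occ v u)%N -> infix v u.
Proof.
elim: u => [|b u IH]; first by rewrite occ_nil.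
rewrite occ_cons addn_gt0 lt0b => /orP[/prefixW //|/IH vu].
exact: infix_trans vu (infix_cons _ _).
Qed.

Lemma expect_size_gt0 n a : 0 < E (rs_iter th n [:: a]) (fun w => (size w)%:R).
Proof.
apply: lt_le_trans ltr01 _; rewrite -[leLHS](expect_cst (rs_iter th n [:: a])).
apply: le_expect => w wa; rewrite ler1n lt0n size_eq0.
by apply: contraTneq wa => ->; apply: rs_iter_nonnil.
Qed.

(** Averaged over the starting letter with weights [r], the ratios of expected
    counts become a convex combination of sequences with the same limit. *)
Lemma freq_lim v :
  mean th r n (fun w => (occ v w)%:R) / lambda ^+ n @[n --> \oo] --> freq v.
Proof.
have [lv|nlv] := pselect (language th v); last first.
  rewrite freq_notin_language //.
  rewrite -(cvg_shiftS (fun n => mean th r n (fun w => (occ v w)%:R) / lambda ^+ n)).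
  rewrite (_ : (fun n => _) = fun=> 0); first exact: cvg_cst.
  apply: funext => n; rewrite /mean big1 ?mul0r // => a _.
  rewrite (eq_expect (h := fun=> 0)); first by rewrite expect_cst mulr0.
  move=> w wa; apply/eqP; rewrite pnatr_eq0 -leqn0 leqNgt; apply/negP => /occ_infix vw.
  by apply: nlv; exists a, n.+1, w.
have [_ _ /(_ v _ lv) lim] := mu_freq.
pose x n a := E (rs_iter th n [:: a]) (fun w => (occ v w)%:R) /
  E (rs_iter th n [:: a]) (fun w => (size w)%:R).
pose err n := \sum_a `|x n a - freq v|.
have err0 : err n @[n --> \oo] --> (0 : R).
  have -> : 0 = \sum_(a < d.+1) (0 : R) by rewrite big1.
  apply: cvg_big => [|a _]; first exact: add_continuous.
  rewrite -[X in _ --> X](normr0 R) -[X in `|X|](subrr (freq v)).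
  by apply: cvg_norm; apply: cvgB; [exact: lim|exact: cvg_cst].
have bnd n : `|mean th r n (fun w => (occ v w)%:R) / lambda ^+ n - freq v| <= err n.
  pose wt a := r a ord0 * E (rs_iter th n [:: a]) (fun w => (size w)%:R) / lambda ^+ n.
  have wt0 a : 0 <= wt a.
    by rewrite !mulr_ge0 ?(ltW (r0 a)) ?(ltW (expect_size_gt0 _ _)) ?invr_ge0 ?exprn_ge0 ?(ltW l0).
  have wt1 : \sum_a wt a = 1.
    by rewrite -mulr_suml -/(mean th r n _) (mean_size r1 PFr) divff ?expf_neq0 ?gt_eqF.
  have -> : mean th r n (fun w => (occ v w)%:R) / lambda ^+ n - freq v =
      \sum_a wt a * (x n a - freq v).
    under [RHS]eq_bigr do rewrite mulrBr; rewrite sumrB -mulr_suml wt1 mul1r.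
    congr (_ - _); rewrite mulr_suml; apply: eq_bigr => a _; rewrite /wt /x; field.
    by rewrite expf_neq0 ?gt_eqF ?expect_size_gt0.
  apply: le_trans (ler_norm_sum _ _ _) _; apply: ler_sum => a _.
  rewrite normrM ger0_norm // ler_piMl // -wt1 (bigD1 a) //= lerDl.
  by apply: sumr_ge0.
apply/cvgrPdist_le => eps eps0.
move/cvgrPdist_le: err0 => /(_ eps eps0); apply: filterS => n.
rewrite sub0r normrN distrC; apply: le_trans; apply: le_trans (bnd n) _.
exact: ler_norm.
Qed.

Lemma measure_entropyE : measure_entropy th mu =
  limn (fun n => n%:R^-1 * block_entropy freq n).
Proof.
rewrite /measure_entropy; congr (limn _); apply: funext => n; congr (_ * _).
rewrite /block_entropy word_sumE big_mkcond; apply: eq_bigr => t _.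
case: ifPn => // /asboolPn /freq_notin_language ->.
by rewrite mul0r oppr0.
Qed.

End FrequencyMeasure.

(** A non-negative eigenvalue is dominated by any Perron-Frobenius eigenvalue;
    the eigenvector is carried to the complex numbers, where domination is
    stated. *)
Lemma PF_eigenvalue_le (R : realType) (d : nat) (M : 'M[R]_d.+1) (l l' : R) :
  0 <= l' -> PF_eigenvalue M l -> PF_eigenvalue M l' -> l' <= l.
Proof.
move=> l'0 [_ dom] [/eigenvalueP[v vM v0] _].
have /dom : eigenvalue (map_mx (real_complex R) M) (l'%:C)%C.
  apply/eigenvalueP; exists (map_mx (real_complex R) v); last by rewrite map_mx_eq0.
  by rewrite -map_mxM vM map_mxZ.
by rewrite ger0_norm ?lecR // (lecR 0).
Qed.

Theorem theorem3p5 (R : realType) (d : nat) (th : random_subst R d)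
    (lambda : R) (r : 'cV[R]_d.+1) (mu : probability (borel_shift d) R)
    (th_prim : primitive_subst th)
    (th_urp : unique_realisation_paths th)
    (lambda_PF : PF_eigenvalue (subst_mx th) lambda)
    (r_PF : right_PF_eigenvector (subst_mx th) lambda r)
    (mu_freq : frequency_measure th mu) :
  let HR := fun k : nat => ((entropy_vec th k)^T *m r) ord0 ord0 in
  let h := measure_entropy th mu in
  (forall k : nat, (0 < k)%N ->
    [/\ (lambda ^+ k)^-1 * HR k <= h,
        h <= (lambda ^+ k - 1)^-1 * HR k,
        h = (lambda ^+ k - 1)^-1 * HR k <->
          disjoint_set_condition (rs_pow th k) &
        (lambda ^+ k)^-1 * HR k = h <->
          identical_set_condition (rs_pow th k) /\
          identical_production_probabilities (rs_pow th k)]) /\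
  (forall m n : nat, (0 < m)%N -> (m <= n)%N ->
    (lambda ^+ m)^-1 * HR m <= (lambda ^+ n)^-1 * HR n).
Proof.
move=> HR h.
have [PFr r0 r1] := r_PF.
have lambda1 : 1 < lambda.
  have [_ [l' l'_PF l'1]] := th_prim; apply: (lt_le_trans l'1).
  by apply: PF_eigenvalue_le l'_PF => //; rewrite ltW // (lt_trans _ l'1).
have HRE k : HR k = mean_entropy th r k.
  by rewrite /HR mxE; apply: eq_bigr => a _; rewrite !mxE mulrC.
have f_lim := freq_lim r0 r1 PFr lambda1 mu_freq.
have hE : h = entropy_limit th r lambda.
  rewrite /h measure_entropyE; apply: (@cvg_lim _ (@Rhausdorff R)).
  exact: block_entropy_cvg.
have SE k : (lambda ^+ k)^-1 * HR k = scaled_entropy th r lambda k by rewrite HRE.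
split=> [k k0|m n m0 mn]; last by rewrite !SE; apply: scaled_entropy_homo.
have mulk0 j : (0 < j.+1 * k)%N by rewrite muln_gt0.
split; rewrite ?SE hE ?HRE.
- exact: (scaled_entropy_le_limit r0 r1 PFr lambda1 f_lim).
- exact: (entropy_limit_le_upper r0 r1 PFr lambda1 f_lim).
- rewrite (upper_bound_eq r0 r1 PFr lambda1 f_lim th_urp k0).
  have iffj j := mean_entropyD_le_eq th_urp r0 PFr k0 (mulk0 j).
  split=> [e a [//|j] u v _ ua va uv|disj j].
    rewrite /rs_supp !rs_iter_pow; exact: ((iffj j).1 (e j) a).
  apply/iffj => a u v ua va uv.
  by have := disj a j.+1 u v isT ua va uv; rewrite /rs_supp !rs_iter_pow.
rewrite (lower_bound_eq r0 r1 PFr lambda1 f_lim th_urp k0).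
have iffj j := mean_entropyD_ge_eq th_urp r0 PFr k0 (mulk0 j).
split=> [e|[_ ipp] j].
  have same a j u v : u \in rs_supp th k [:: a] -> v \in rs_supp th k [:: a] ->
      rs_iter (rs_pow th k) j.+1 u = rs_iter (rs_pow th k) j.+1 v.
    by move=> ua va; rewrite !rs_iter_pow; exact: ((iffj j).1 (e j) a).
  split=> [a [//|j] u v _ ua va|a [|[|j]] // v u1 u2 _ _ u1a u2a].
    by rewrite /rs_supp (same a j u v).
  by rewrite (same a j u1 u2).
apply/iffj => a u v ua va.
rewrite -!rs_iter_pow; apply: fdist_ext => w.
have [wa|wa] := boolP (w \in rs_supp (rs_pow th k) j.+2 [:: a]).
  exact: (ipp a j.+2 w u v isT wa ua va).
have out u' : u' \in rs_supp th k [:: a] -> rs_iter (rs_pow th k) j.+1 u' w = 0.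
  move=> ua'; apply: fsfun_dflt; apply: contra wa => wu.
  rewrite /rs_supp -[j.+2]add1n rs_iterD; apply: mem_bind wu.
  by rewrite rs_iter_pow mul1n.
by rewrite !out.
Qed.
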